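(* Let $\mathbb{T}\colon\mathbb{R}^d\to\mathbb{R}^d$ be nonexpansive with a fixed point $x_\star$, and let $\mathbb{T}(\cdot;\xi)$ be a jointly measurable stochastic oracle such that for all deterministic $x,y\in\mathbb{R}^d$, $$\mathbb{E}[\mathbb{T}(x;\xi)]=\mathbb{T}(x),\quad \mathbb{E}\left[\|\mathbb{T}(x;\xi)-\mathbb{T}(x)\|^2\right]\le\tau^2,\quad \mathbb{E}\left[\|\mathbb{T}(x;\xi)-\mathbb{T}(y;\xi)\|^2\right]\le\|x-y\|^2 .$$ Let $\epsilon>0$, and let $x_0\in\mathbb{R}^d$ satisfy $\|x_0-x_\star\|\le D$. Set $$N=\max\left\{2,\left\lceil\frac{4D}{\epsilon}\right\rceil\right\},\quad a_{N,k}=\frac{1}{(N-k)(N-k-1)},\quad S_N=\sum_{k=0}^{N-2}\sqrt{a_{N,k}},\quad Q=\max\left\{1,\frac{8\tau^2S_N^2}{\epsilon^2}\right\},$$ $$B_k=\left\lceil\frac{Q\sqrt{a_{N,k}}}{S_N}\right\rceil,\qquad k=0,\dots,N-2 .$$ Let $\mathbb{T}_k(x)=\frac{1}{B_k}\sum_{\xi\in\mathcal{B}_k}\mathbb{T}(x;\xi)$, where $\mathcal{B}_k$ consists of $B_k$ independent samples of $\xi$ and the mini-batches $\mathcal{B}_0,\dots,\mathcal{B}_{N-2}$ are independent. Let $x_1,\dots,x_{N-1}$ be generated by $$x_{k+1}=x_k+\frac{N-k-1}{N-k}\left(\mathbb{T}_k(x_k)-\mathbb{T}_{k-1}(x_{k-1})\right),\qquad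 k=0,\dots,N-2,\qquad \mathbb{T}_{-1}(x_{-1}):=x_0 .$$ Then this algorithm attains $$\mathbb{E}\left[\|x_{N-1}-\mathbb{T}(x_{N-1})\|^2\right]\le\epsilon^2$$ using $$\mathcal{O}\!\left(\frac{D}{\epsilon}+\frac{\tau^2}{\epsilon^2}\left(1+\log\left(1+\frac{D}{\epsilon}\right)\right)^2\right)$$ oracle evaluations.
   Context: $\|\cdot\|$ is the Euclidean norm. A map $\mathbb{T}$ is nonexpansive if $\|\mathbb{T}(x)-\mathbb{T}(y)\|\le\|x-y\|$ for all $x,y\in\mathbb{R}^d$. One evaluation of the mini-batch map $\mathbb{T}_k$ at a point costs $B_k$ oracle evaluations; each $\mathbb{T}_k$ is evaluated once (at $x_k$), and the value $\mathbb{T}_{k-1}(x_{k-1})$ is reused from the previous step, so the total number of oracle evaluations is $\sum_{k=0}^{N-2}B_k$.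
   Formalization: The number of oracle evaluations is bounded by an absolute constant times max{1, D/ε + (τ²/ε²)(1+log(1+D/ε))²}, since at least one evaluation is always made while the expression inside O(·) is 0 when D = τ = 0. *)

(* Defs.v *)
From HB Require Import structures.
From mathcomp Require Import all_boot all_order all_algebra.
From mathcomp Require Import all_classical all_reals all_analysis.

Set Implicit Arguments.
Unset Strict Implicit.
Unset Printing Implicit Defensive.

Import Order.TTheory GRing.Theory Num.Theory.
Import numFieldNormedType.Exports.

Local Open Scope classical_set_scope.
Local Open Scope ring_scope.

(* The library norm `|x| on 'rV[R]_d is the sup norm. *)
Definition enorm (R : realType) (d : nat) (x : 'rV[R]_d) : R :=
  Num.sqrt (\sum_(i < d) x 0 i ^+ 2).

Definition nonexpansive (R : realType) (d : nat) (T : 'rV[R]_d -> 'rV[R]_d) :=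
  forall x y, enorm (T x - T y) <= enorm (x - y).

(* R^d with its Borel sigma-algebra: the sup norm and the Euclidean norm have
   the same open sets. *)
Definition borel_rV (R : realType) (d : nat) :=
  g_sigma_algebraType (@open 'rV[R]_d).

Definition jointly_measurable (R : realType) (d : nat) (dX : measure_display)
    (Xi : measurableType dX) (To : 'rV[R]_d -> Xi -> 'rV[R]_d) :=
  measurable_fun [set: borel_rV R d * Xi]
    (fun p : borel_rV R d * Xi => To p.1 p.2 : borel_rV R d).

Definition independent_systems (R : realType) (dO : measure_display)
    (Omega : measurableType dO) (P : probability Omega R) (I : eqType)
    (F : I -> set (set Omega)) :=
  forall s : seq I, uniq s ->
  forall A : I -> set Omega, (forall i, i \in s -> F i (A i)) ->
  P (\big[setI/setT]_(i <- s) A i) = (\prod_(i <- s) P (A i))%E.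

(* The samples of batch k are xi k j with k < n and j < B k; the values of xi
   at other indices are irrelevant.  The sigma-algebra of batch k is the one
   generated by all of its samples. *)
Definition independent_minibatches (R : realType) (dO dX : measure_display)
    (Omega : measurableType dO) (Xi : measurableType dX)
    (P : probability Omega R) (n : nat) (B : nat -> nat)
    (xi : nat -> nat -> {RV P >-> Xi}) :=
  (forall k, (k < n)%N ->
     independent_systems P (fun j : 'I_(B k) =>
       preimage_set_system setT (xi k j) measurable)) /\
  independent_systems P (fun k : 'I_n =>
    g_sigma_preimage (fun j : 'I_(B k) => (xi k j : Omega -> Xi))).

(* `|Num.ceil r|%N is the ceiling as a natural number; it is only used at
   r >= 0, where the absolute value does nothing. *)
Definition horizon (R : realType) (D eps : R) : nat :=
  maxn 2 `|Num.ceil (4 * D / eps)|%N.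

Definition acoef (R : realType) (N k : nat) : R :=
  ((N - k)%:R * (N - k - 1)%:R)^-1.

Definition Ssum (R : realType) (N : nat) : R :=
  \sum_(k < N.-1) Num.sqrt (acoef R N k).

Definition Qparam (R : realType) (tau eps : R) (N : nat) : R :=
  Num.max 1 (8 * tau ^+ 2 * Ssum R N ^+ 2 / eps ^+ 2).

Definition batch_size (R : realType) (tau eps : R) (N k : nat) : nat :=
  `|Num.ceil (Qparam tau eps N * Num.sqrt (acoef R N k) / Ssum R N)|%N.

Definition minibatch (R : realType) (d : nat) (Xi : Type)
    (To : 'rV[R]_d -> Xi -> 'rV[R]_d) (b : nat) (s : nat -> Xi)
    (x : 'rV[R]_d) : 'rV[R]_d :=
  b%:R^-1 *: \sum_(j < b) To x (s j).

(* Tk_(k-1) (x_(k-1)), with the convention Tk_(-1) (x_(-1)) := x0. *)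
Definition prev_value (V : Type) (x0 : V) (Tk : nat -> V -> V) (x : nat -> V)
    (k : nat) : V :=
  if k is k'.+1 then Tk k' (x k') else x0.

Definition generated_iterates (R : realType) (d : nat) (N : nat)
    (x0 : 'rV[R]_d) (Tk : nat -> 'rV[R]_d -> 'rV[R]_d) (x : nat -> 'rV[R]_d) :=
  x 0%N = x0 /\
  forall k, (k < N.-1)%N ->
    x k.+1 = x k + ((N - k - 1)%:R / (N - k)%:R) *:
                     (Tk k (x k) - prev_value x0 Tk x k).

(* Step k costs one evaluation of the mini-batch map, that is B k oracle
   evaluations: the value prev_value is reused. *)
Definition oracle_evaluations (N : nat) (B : nat -> nat) : nat :=
  (\sum_(k < N.-1) B k)%N.

Definition complexity (R : realType) (D tau eps : R) : R :=
  D / eps + tau ^+ 2 / eps ^+ 2 * (1 + ln (1 + D / eps)) ^+ 2.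

(* Main.v *)
(* Write y_k for the batch value at x_k, e_k = y_k - T x_k for its noise and
   r = x_(N-1) - T x_(N-1).  A quadratic potential that telescopes along the
   path, together with nonexpansiveness at the fixed point, gives
     |r|^2 <= (2/N) <r, x_0 - x_star>
              + sum_k a_(N,k) (|y_k - T x_(N-1)|^2 - |x_k - x_(N-1)|^2),
   so it remains to bound the mean of the cross terms <e_k, T x_(N-1)>, although
   x_(N-1) depends on e_k.  Let x' be the path in which batch k alone is
   replaced by the exact map T.  Then T x'_(N-1) is independent of batch k, so
   its cross term with e_k has mean zero.  Moreover each x_(k+1) is a convex
   combination of x_0 and y_0, ..., y_k, so by Jensen's inequality and the
   mean-square nonexpansiveness of the other batches,
   E |x_(N-1) - x'_(N-1)|^2 <= tau^2 / B_k, the bound on E |e_k|^2.  Hence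
     E |r|^2 <= 4 D^2 / N^2 + 6 sum_k a_(N,k) tau^2 / B_k,
   and the choice of N and B_k makes this at most eps^2. *)
From HB Require Import structures.
Require Import Defs.
From mathcomp Require Import all_boot all_order all_algebra.
From mathcomp Require Import all_classical all_reals all_analysis.
From mathcomp Require Import measurable_realfun.
From mathcomp Require Import ring lra zify.

Set Implicit Arguments.
Unset Strict Implicit.
Unset Printing Implicit Defensive.

Import Order.TTheory GRing.Theory Num.Theory.
Import numFieldNormedType.Exports.

Local Open Scope classical_set_scope.
Local Open Scope ring_scope.

(** * Euclidean geometry *)

Definition dot (R : realType) (d : nat) (x y : 'rV[R]_d) : R :=
  \sum_(i < d) x 0 i * y 0 i.

Lemma sqr_enorm (R : realType) (d : nat) (x : 'rV[R]_d) :
  enorm x ^+ 2 = \sum_(i < d) x 0 i ^+ 2.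
Proof. by rewrite sqr_sqrtr// sumr_ge0// => i _; rewrite sqr_ge0. Qed.

Lemma enorm_ge0 (R : realType) (d : nat) (x : 'rV[R]_d) : 0 <= enorm x.
Proof. exact: sqrtr_ge0. Qed.

Lemma nonexpansive_sqr (R : realType) (d : nat) (T : 'rV[R]_d -> 'rV[R]_d) :
  nonexpansive T -> forall x y, enorm (T x - T y) ^+ 2 <= enorm (x - y) ^+ 2.
Proof. by move=> Tne x y; rewrite lerXn2r ?nnegrE ?enorm_ge0. Qed.

Lemma sqr_enormB (R : realType) (d : nat) (x y : 'rV[R]_d) :
  enorm (x - y) ^+ 2 = enorm x ^+ 2 - 2 * dot x y + enorm y ^+ 2.
Proof.
rewrite !sqr_enorm /dot mulr_sumr -sumrB -big_split/=.
by apply: eq_bigr => i _; rewrite !mxE; ring.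
Qed.

Lemma sqr_enormD (R : realType) (d : nat) (x y : 'rV[R]_d) :
  enorm (x + y) ^+ 2 = enorm x ^+ 2 + 2 * dot x y + enorm y ^+ 2.
Proof.
rewrite !sqr_enorm /dot mulr_sumr -!big_split/=.
by apply: eq_bigr => i _; rewrite !mxE; ring.
Qed.

Lemma dotDr (R : realType) (d : nat) (x y z : 'rV[R]_d) :
  dot x (y + z) = dot x y + dot x z.
Proof.
by rewrite /dot -big_split/=; apply: eq_bigr => i _; rewrite mxE mulrDr.
Qed.

Lemma dotZr (R : realType) (d : nat) (a : R) (x y : 'rV[R]_d) :
  dot x (a *: y) = a * dot x y.
Proof.
by rewrite /dot mulr_sumr; apply: eq_bigr => i _; rewrite mxE mulrCA.
Qed.

Lemma dot_sumr (R : realType) (d n : nat) (x : 'rV[R]_d)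
    (Y : 'I_n -> 'rV[R]_d) :
  dot x (\sum_(j < n) Y j) = \sum_(j < n) dot x (Y j).
Proof.
rewrite /dot exchange_big/=; apply: eq_bigr => i _.
by rewrite summxE mulr_sumr.
Qed.

Lemma dotC (R : realType) (d : nat) (x y : 'rV[R]_d) : dot x y = dot y x.
Proof. by apply: eq_bigr => i _; rewrite mulrC. Qed.

Lemma dotxx (R : realType) (d : nat) (x : 'rV[R]_d) : dot x x = enorm x ^+ 2.
Proof. by rewrite sqr_enorm; apply: eq_bigr => i _; rewrite expr2. Qed.

Lemma dot_young (R : realType) (d : nat) (t : R) (x y : 'rV[R]_d) : 0 < t ->
  2 * dot x y <= t * enorm x ^+ 2 + enorm y ^+ 2 / t.
Proof.
move=> t0; rewrite -(ler_pM2l t0) -subr_ge0.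
have -> : t * (t * enorm x ^+ 2 + enorm y ^+ 2 / t) - t * (2 * dot x y)
    = enorm (t *: x - y) ^+ 2.
  rewrite sqr_enormB [dot (t *: x) y]dotC dotZr [dot y x]dotC -(dotxx (t *: x)).
  rewrite dotZr [dot (t *: x) x]dotC dotZr dotxx; field.
  by rewrite gt_eqF.
exact: sqr_ge0.
Qed.

(** * The deterministic recursion *)

Definition step_weight (R : realType) (N k : nat) : R :=
  (N - k - 1)%:R / (N - k)%:R.

(** [Y] is not tied to [X] by any map, so the same algebra serves the noisy path and every path in
    which some steps are exact. *)
Definition follows_dual_halpern (R : realType) (d : nat) (N : nat)
    (x0 : 'rV[R]_d) (X Y : nat -> 'rV[R]_d) :=
  X 0%N = x0 /\
  forall k, (k < N.-1)%N ->
    X k.+1 = X k + step_weight R N k *: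
                     (Y k - (if k is k'.+1 then Y k' else x0)).

(** Turns the truncated subtractions into real ones: the denominators of the recursion become M and
    M - 1 with M > 1, which [field] can clear. *)
Lemma natr_horizon_sub (R : realType) (N k : nat) : (k < N.-1)%N ->
  [/\ (N - k - 1)%:R = (N - k)%:R - 1 :> R,
      (N - k.+1)%:R = (N - k)%:R - 1 :> R & 1 < (N - k)%:R :> R].
Proof.
move=> kN; have h : (1 <= N - k)%N by lia.
have -> : (N - k.+1 = N - k - 1)%N by lia.
by rewrite natrB//; split=> //; rewrite ltr1n; lia.
Qed.

(* With M = N - k, v = X k - Y k.-1 - (X N.-1 - y) and z = X k - X N.-1, the
   summand of index k is Phi_(k+1) - Phi_k for
   Phi_k = 2 v z / M + (1 - 1/M) v^2. *)
Lemma dual_halpern_identity_coord (R : realType) (N : nat) (X Y : nat -> R)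
    (y : R) : (1 < N)%N ->
  (forall k, (k < N.-1)%N ->
    X k.+1 = X k + step_weight R N k *
                     (Y k - (if k is k'.+1 then Y k' else X 0%N))) ->
  \sum_(k < N.-1) acoef R N k * ((X k - X N.-1) ^+ 2 - (Y k - y) ^+ 2) =
  2 / N%:R * (X N.-1 - y) * (X 0%N - X N.-1)
    - (1 - N%:R^-1) * (X N.-1 - y) ^+ 2.
Proof.
move=> N1 recX.
set r := X N.-1 - y.
pose v k := X k - (if k is k'.+1 then Y k' else X 0%N) - r.
pose z k := X k - X N.-1.
pose Phi k := 2 * v k * z k / (N - k)%:R + (1 - (N - k)%:R^-1) * v k ^+ 2.
rewrite -(big_mkord xpredT
  (fun k => acoef R N k * ((X k - X N.-1) ^+ 2 - (Y k - y) ^+ 2))).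
rewrite (@telescope_sumr_eq _ _ _ Phi)//; last first.
  move=> k /andP[_ kN]; rewrite /Phi /acoef.
  have [-> -> M1] := natr_horizon_sub R kN.
  set M : R := (N - k)%:R in M1 *.
  have M0 : M != 0 by rewrite gt_eqF//; lra.
  have M10 : M - 1 != 0 by rewrite gt_eqF//; lra.
  pose yp := if k is k'.+1 then Y k' else X 0%N.
  have vk : v k = X k - yp - r by [].
  have vk1 : v k.+1 = v k - (Y k - yp) / M.
    rewrite vk /v recX// -/yp /step_weight.
    have [-> _ _] := natr_horizon_sub R kN.
    by rewrite -/M; field.
  have zk1 : z k.+1 = z k + (M - 1) / M * (Y k - yp).
    rewrite /z recX// -/yp /step_weight.
    have [-> _ _] := natr_horizon_sub R kN.
    by rewrite -/M; field.
  have -> : Y k - y = (Y k - yp) + z k - v k.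
    rewrite vk /z /r; ring.
  rewrite -/(z k) zk1 vk1.
  by field; rewrite M0 M10.
(* Only Phi_0 survives. At the index N - 1 both z and 1 - 1/M vanish, as M = 1 there; at the index 0
   the convention for the previous value gives v = -r. *)
rewrite /Phi /v /z subrr mulr0 mul0r.
have -> : (N - N.-1 = 1)%N by lia.
rewrite invr1 subrr mul0r addr0 sub0r.
rewrite subn0 subrr sub0r sqrrN opprD; congr (_ - _).
ring.
Qed.

Lemma acoef_ge0 (R : realType) (N k : nat) : 0 <= acoef R N k.
Proof. by rewrite invr_ge0 mulr_ge0. Qed.

Lemma dual_halpern_identity (R : realType) (d N : nat) (x0 y : 'rV[R]_d)
    (X Y : nat -> 'rV[R]_d) : (1 < N)%N -> follows_dual_halpern N x0 X Y ->
  \sum_(k < N.-1) acoef R N k *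
      (enorm (X k - X N.-1) ^+ 2 - enorm (Y k - y) ^+ 2) =
  2 / N%:R * dot (X N.-1 - y) (x0 - X N.-1)
    - (1 - N%:R^-1) * enorm (X N.-1 - y) ^+ 2.
Proof.
move=> N1 [X0 recX]; rewrite !sqr_enorm /dot !mulr_sumr -sumrB.
under eq_bigr => k _ do rewrite !sqr_enorm -sumrB mulr_sumr.
rewrite exchange_big/=; apply: eq_bigr => i _.
under eq_bigr => k _ do rewrite !mxE.
rewrite (@dual_halpern_identity_coord _ _ (fun k => X k 0 i)
  (fun k => Y k 0 i))//; first by rewrite -X0 !mxE; ring.
by move=> k kN; rewrite recX// !mxE; case: k {kN} => [|k]; rewrite ?X0.
Qed.

(* The noise enters through [e k = Y k - T (X k)], and [X' k] is free: it will
   be a last iterate that does not depend on [e k]. *)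
Lemma dual_halpern_residual (R : realType) (d N : nat)
    (T : 'rV[R]_d -> 'rV[R]_d) (xs x0 : 'rV[R]_d) (X Y X' : nat -> 'rV[R]_d) :
  nonexpansive T -> T xs = xs -> (1 < N)%N -> follows_dual_halpern N x0 X Y ->
  enorm (X N.-1 - T (X N.-1)) ^+ 2 <=
    4 / N%:R ^+ 2 * enorm (x0 - xs) ^+ 2 +
    \sum_(k < N.-1) 2 * acoef R N k *
      (2 * dot (Y k - T (X k)) (T (X k) - T (X' k)) +
       2 * enorm (Y k - T (X k)) ^+ 2 + enorm (X' k - X N.-1) ^+ 2).
Proof.
move=> Tne Txs N1 XY.
set xN := X N.-1; set r := xN - T xN.
have N0 : 0 < N%:R :> R by rewrite ltr0n; lia.
(* Nonexpansiveness between [xN] and the fixed point, with [T xN - T xs] written as [(xN - xs) - r]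
   and the square expanded. *)
have mono : enorm r ^+ 2 <= 2 * dot r (xN - xs).
  have := nonexpansive_sqr Tne xN xs.
  have -> : T xN - T xs = (xN - xs) - r.
    by rewrite Txs /r opprB [RHS]addrC [RHS]addrA subrK.
  by rewrite sqr_enormB [dot (xN - xs) r]dotC; lra.
(* After division by N, the parameter N/2 costs exactly half of |r|^2. Absorbing this half on the
   left doubles the remaining terms, whence 4/N^2 and the factor 2 before [acoef]. *)
have young : 2 * dot r (x0 - xs) <=
    N%:R / 2 * enorm r ^+ 2 + enorm (x0 - xs) ^+ 2 / (N%:R / 2).
  by apply: dot_young; lra.
have split_dot : dot r (x0 - xs) = dot r (x0 - xN) + dot r (xN - xs).
  by rewrite -dotDr addrA subrK.
(* With e the noise, |T (X k) - T xN|^2 is cancelled by -|X k - xN|^2. The cross term is split at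
   [T (X' k)]; the part against [T (X' k) - T xN] goes to Young's inequality and adds a second
   |e|^2. *)
have noise k : enorm (Y k - T xN) ^+ 2 - enorm (X k - xN) ^+ 2 <=
    2 * dot (Y k - T (X k)) (T (X k) - T (X' k)) +
       2 * enorm (Y k - T (X k)) ^+ 2 + enorm (X' k - xN) ^+ 2.
  have -> : Y k - T xN = (Y k - T (X k)) + (T (X k) - T xN).
    by rewrite addrA subrK.
  rewrite sqr_enormD; set e := Y k - T (X k).
  have -> : dot e (T (X k) - T xN) =
      dot e (T (X k) - T (X' k)) + dot e (T (X' k) - T xN).
    by rewrite -dotDr addrA subrK.
  have := @dot_young _ _ 1 e (T (X' k) - T xN) ltr01.
  have := nonexpansive_sqr Tne (X k) xN.
  have := nonexpansive_sqr Tne (X' k) xN.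
  rewrite divr1 mul1r; lra.
have := dual_halpern_identity (T xN) N1 XY; rewrite -/xN -/r => id.
have : - \sum_(k < N.-1) acoef R N k *
      (enorm (X k - xN) ^+ 2 - enorm (Y k - T xN) ^+ 2) <=
   \sum_(k < N.-1) acoef R N k *
      (2 * dot (Y k - T (X k)) (T (X k) - T (X' k)) +
       2 * enorm (Y k - T (X k)) ^+ 2 + enorm (X' k - xN) ^+ 2).
  rewrite -sumrN ler_sum// => k _.
  by rewrite -mulrN opprB ler_wpM2l// acoef_ge0.
under [X in _ -> _ <= _ + X]eq_bigr => k _ do rewrite -mulrA.
rewrite -mulr_sumr id; set S := \sum_(_ < _) _ => bnd.
have -> : 4 / N%:R ^+ 2 * enorm (x0 - xs) ^+ 2 =
    2 / N%:R * (enorm (x0 - xs) ^+ 2 / (N%:R / 2)).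
  by field; rewrite gt_eqF.
have : 2 / N%:R * (2 * dot r (x0 - xN)) <= 2 / N%:R *
  ((N%:R / 2 - 1) * enorm r ^+ 2 + enorm (x0 - xs) ^+ 2 / (N%:R / 2)).
  by rewrite ler_pM2l ?divr_gt0//; lra.
rewrite (_ : 2 / N%:R * ((N%:R / 2 - 1) * _ + _) = enorm r ^+ 2
    - 2 * (N%:R^-1 * enorm r ^+ 2)
    + 2 / N%:R * (enorm (x0 - xs) ^+ 2 / (N%:R / 2))); last first.
  by field; rewrite gt_eqF.
by move: bnd; rewrite mulrBl mul1r => *; lra.
Qed.

(** The coefficient of [Y j] in the closed form of [X k.+1]; the starting point carries the rest,
    1/N. *)
Definition mix_weight (R : realType) (N k j : nat) : R :=
  if (j < k)%N then acoef R N j else step_weight R N k.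

Lemma step_weight_ge0 (R : realType) (N k : nat) : 0 <= step_weight R N k.
Proof. by rewrite divr_ge0. Qed.

Lemma mix_weight_ge0 (R : realType) (N k j : nat) : 0 <= mix_weight R N k j.
Proof.
by rewrite /mix_weight; case: ifP; rewrite ?acoef_ge0 ?step_weight_ge0.
Qed.

(** With M = N - k the two weights are 1 - 1/M and 1 - 1/(M - 1), and 1/(M - 1) - 1/M = 1/(M (M -
    1)). *)
Lemma step_weightB (R : realType) (N k : nat) : (k.+1 < N.-1)%N ->
  step_weight R N k - step_weight R N k.+1 = acoef R N k.
Proof.
move=> kN; have kN' : (k < N.-1)%N by lia.
rewrite /step_weight /acoef.
have [-> _ M2] := natr_horizon_sub R kN.
have [-> -> M1] := natr_horizon_sub R kN'.
have [_ e _] := natr_horizon_sub R kN'; rewrite e in M2.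
by field; apply/andP; split; rewrite gt_eqF//; lra.
Qed.

Lemma big_mix_weight (R : realType) (V : zmodType) (N k : nat)
    (F : R -> nat -> V) :
  \sum_(j < k.+1) F (mix_weight R N k j) j =
  \sum_(j < k) F (acoef R N j) j + F (step_weight R N k) k.
Proof.
rewrite big_ord_recr/= /mix_weight ltnn; congr (_ + _).
by apply: eq_bigr => j _; rewrite ltn_ord.
Qed.

(** One more step lets [Y k.+1] enter with its step weight and subtracts the same weight from [Y k],
    whose coefficient drops to [acoef N k] and never changes again. *)
Lemma follows_dual_halpernE (R : realType) (d N : nat) (x0 : 'rV[R]_d)
    (X Y : nat -> 'rV[R]_d) (k : nat) :
  follows_dual_halpern N x0 X Y -> (k < N.-1)%N ->
  X k.+1 = N%:R^-1 *: x0 + \sum_(j < k.+1) mix_weight R N k j *: Y j.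
Proof.
move=> [X0 recX]; elim: k => [|k IHk] kN.
  rewrite recX// X0 big_ord1 /mix_weight ltnn scalerBr addrCA -{1}[x0]scale1r.
  rewrite -scalerBl [RHS]addrC; congr (_ + _ *: _).
  rewrite /step_weight; have [-> _ M1] := natr_horizon_sub R kN.
  by rewrite subn0 in M1 *; field; rewrite gt_eqF//; lra.
rewrite recX// IHk; last exact: ltnW.
rewrite !(big_mix_weight N _ (fun w j => w *: Y j)) big_ord_recr/=.
rewrite -step_weightB// !scalerBr scalerBl.
by rewrite -!addrA; do 3!congr (_ + _); exact: addrC.
Qed.

(** The sum telescopes to 1 - 1/N, whatever k is. *)
Lemma sum_mix_weight_le1 (R : realType) (N k : nat) : (k < N.-1)%N ->
  \sum_(j < k.+1) mix_weight R N k j <= 1.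
Proof.
move=> kN; suff -> : \sum_(j < k.+1) mix_weight R N k j = step_weight R N 0.
  rewrite /step_weight ler_pdivrMr ?mul1r ?ler_nat ?ltr0n; lia.
elim: k kN => [|k IHk] kN; first by rewrite big_ord1 /mix_weight ltnn.
have {}IHk := IHk (ltnW kN).
have E n := big_mix_weight N n (fun (w : R) _ => w).
by rewrite E big_ord_recr/= -step_weightB// -IHk E -addrA subrK.
Qed.

(** Jensen's inequality, from the nonnegativity of the weighted variance about m in each coordinate.
    A total weight below 1 is harmless: it amounts to placing the missing mass at the origin. *)
Lemma sqr_enorm_convex (R : realType) (d : nat) (I : finType) (w : I -> R)
    (v : I -> 'rV[R]_d) : (forall i, 0 <= w i) -> \sum_i w i <= 1 ->
  enorm (\sum_i w i *: v i) ^+ 2 <= \sum_i w i * enorm (v i) ^+ 2.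
Proof.
move=> w0 w1; rewrite sqr_enorm.
under [leRHS]eq_bigr => i _ do rewrite sqr_enorm mulr_sumr.
rewrite exchange_big/=; apply: ler_sum => l _.
rewrite summxE; under [X in X ^+ 2 <= _]eq_bigr => i _ do rewrite mxE.
set m := \sum_i _.
have : 0 <= \sum_i w i * (v i 0 l - m) ^+ 2.
  by apply: sumr_ge0 => i _; rewrite mulr_ge0// sqr_ge0.
have -> : \sum_i w i * (v i 0 l - m) ^+ 2 = \sum_i w i * v i 0 l ^+ 2
    - 2 * m * (\sum_i w i * v i 0 l) + (\sum_i w i) * m ^+ 2.
  rewrite mulr_sumr mulr_suml -sumrB -big_split/=.
  by apply: eq_bigr => i _; ring.
rewrite -/m.
have : (\sum_i w i) * m ^+ 2 <= m ^+ 2 by rewrite ler_piMl// sqr_ge0.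
by rewrite expr2; lra.
Qed.

(** The common starting point cancels in the closed forms, and Jensen's inequality applies to what
    is left. *)
Lemma dual_halpern_stability (R : realType) (d N : nat) (x0 : 'rV[R]_d)
    (X Y X' Y' : nat -> 'rV[R]_d) (k : nat) :
  follows_dual_halpern N x0 X Y -> follows_dual_halpern N x0 X' Y' ->
  (k < N.-1)%N ->
  enorm (X k.+1 - X' k.+1) ^+ 2 <=
    \sum_(j < k.+1) mix_weight R N k j * enorm (Y j - Y' j) ^+ 2.
Proof.
move=> XY XY' kN.
rewrite (follows_dual_halpernE XY kN) (follows_dual_halpernE XY' kN).
rewrite opprD addrACA subrr add0r -sumrB.
under eq_bigr => j _ do rewrite -scalerBr.
apply: sqr_enorm_convex => [j|]; first exact: mix_weight_ge0.
exact: sum_mix_weight_le1.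
Qed.

(** * Parameters and oracle complexity *)

Lemma absz_ceil_itv (R : realType) (x : R) : 0 <= x ->
  x <= `|Num.ceil x|%N%:R < x + 1.
Proof.
move=> x0; have c0 : 0 <= Num.ceil x by rewrite ceil_ge0; lra.
rewrite natr_absz ger0_norm// ceil_ge/=.
by have := ceilB1_lt x; rewrite intrD; lra.
Qed.

Lemma horizon_gt1 (R : realType) (D eps : R) : (1 < horizon D eps)%N.
Proof. by rewrite /horizon leq_max. Qed.

Lemma horizon_ge (R : realType) (D eps : R) : 0 <= D -> 0 < eps ->
  4 * D / eps <= (horizon D eps)%:R.
Proof.
move=> D0 e0; have d0 : 0 <= 4 * D / eps by rewrite divr_ge0 ?mulr_ge0// ltW.
have /andP[h _] := absz_ceil_itv d0.
by rewrite (le_trans h)// ler_nat leq_maxr.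
Qed.

Lemma horizon_pred_le (R : realType) (D eps : R) : 0 <= D -> 0 < eps ->
  (horizon D eps).-1%:R <= 1 + 4 * D / eps.
Proof.
move=> D0 e0; have d0 : 0 <= 4 * D / eps by rewrite divr_ge0 ?mulr_ge0// ltW.
have /andP[_ h] := absz_ceil_itv d0.
rewrite /horizon; case: (leqP 2 `|Num.ceil (4 * D / eps)|%N) => ?; last first.
  by rewrite /=; lra.
by rewrite -subn1 natrB; [lra|lia].
Qed.

(** Each increment is controlled by ln (1 + x) <= x at x = -1/(n + 2), that is 1/(n + 2) <= ln (n +
    2) - ln (n + 1). *)
Lemma harmonic_le_ln (R : realType) (n : nat) :
  \sum_(m < n.+1) m.+1%:R^-1 <= 1 + ln n.+1%:R :> R.
Proof.
elim: n => [|n IHn]; first by rewrite big_ord1 invr1 ln1 addr0.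
rewrite big_ord_recr/=.
have n1 : 0 < n.+1%:R :> R by rewrite ltr0n.
have n2 : 0 < n.+2%:R :> R by rewrite ltr0n.
have : ln (1 + - n.+2%:R^-1) <= - n.+2%:R^-1 :> R.
  by apply: le_ln1Dx; rewrite ltrN2 invf_lt1// ltr1n.
have -> : 1 + - n.+2%:R^-1 = n.+1%:R / n.+2%:R :> R.
  by rewrite -[n.+2]addn1 natrD in n2 *; field; rewrite gt_eqF.
rewrite ln_div ?posrE//; move: IHn.
by move: (\sum_(_ < _) _) (ln _) (ln _) (_^-1) => *; lra.
Qed.

Lemma acoef_gt0 (R : realType) (N k : nat) : (k < N.-1)%N -> 0 < acoef R N k.
Proof. by move=> kN; rewrite invr_gt0 mulr_gt0// ltr0n; lia. Qed.

Lemma Ssum_gt0 (R : realType) (N : nat) : (1 < N)%N -> 0 < Ssum R N.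
Proof.
case: N => [|[|N]]// _; rewrite /Ssum big_ord_recl ltr_pwDl//.
  by rewrite sqrtr_gt0 acoef_gt0.
by rewrite sumr_ge0// => i _; rewrite sqrtr_ge0.
Qed.

Lemma Ssum_le_ln (R : realType) (N : nat) : (1 < N)%N ->
  Ssum R N <= 1 + ln N.-1%:R.
Proof.
case: N => [|[|N]]// _; apply: le_trans (harmonic_le_ln R N).
(* Read backwards, the terms are 1 / sqrt ((m + 1) (m + 2)), each at most 1 / (m + 1). *)
rewrite /Ssum/= (reindex_inj rev_ord_inj)/=; apply: ler_sum => m _.
have mN := ltn_ord m.
rewrite -(@ler_pXn2r _ 2) ?nnegrE ?sqrtr_ge0 ?invr_ge0// sqr_sqrtr ?acoef_ge0//.
rewrite /acoef exprVn expr2 subSS.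
have -> : (N.+2 - (N - m) = m.+2)%N by lia.
rewrite subn1/= lef_pV2 ?posrE ?mulr_gt0 ?ltr0n// ler_wpM2r// ler_nat; lia.
Qed.

Lemma Qparam_ge1 (R : realType) (tau eps : R) (N : nat) :
  1 <= Qparam tau eps N.
Proof. by rewrite /Qparam le_max lexx. Qed.

Lemma batch_size_itv (R : realType) (tau eps : R) (N k : nat) : (1 < N)%N ->
  Qparam tau eps N * Num.sqrt (acoef R N k) / Ssum R N
    <= (batch_size tau eps N k)%:R
    < Qparam tau eps N * Num.sqrt (acoef R N k) / Ssum R N + 1.
Proof.
move=> N1; apply: absz_ceil_itv.
have Q1 := Qparam_ge1 tau eps N; have S0 := Ssum_gt0 R N1.
by rewrite divr_ge0 ?mulr_ge0 ?sqrtr_ge0//; lra.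
Qed.

Lemma batch_size_gt0 (R : realType) (tau eps : R) (N k : nat) :
  (1 < N)%N -> (k < N.-1)%N -> (0 < batch_size tau eps N k)%N.
Proof.
move=> N1 kN; rewrite -(ltr0n R).
have /andP[+ _] := batch_size_itv tau eps k N1; apply: lt_le_trans.
have Q1 := Qparam_ge1 tau eps N.
by rewrite divr_gt0 ?mulr_gt0 ?sqrtr_gt0 ?acoef_gt0 ?Ssum_gt0//; lra.
Qed.

(** Since B_k >= Q sqrt(a_k) / S, the summand is at most sqrt(a_k) tau^2 S / Q. These sum to tau^2
    S^2 / Q, and Q was chosen to make this at most eps^2 / 8. *)
Lemma batch_noise_le (R : realType) (tau eps : R) (N : nat) : (1 < N)%N ->
  0 < eps ->
  \sum_(k < N.-1) acoef R N k * (tau ^+ 2 / (batch_size tau eps N k)%:R)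
    <= eps ^+ 2 / 8.
Proof.
move=> N1 e0; have S0 := Ssum_gt0 R N1.
have Q0 : 0 < Qparam tau eps N by have := Qparam_ge1 tau eps N; lra.
have hQ : 8 * tau ^+ 2 * Ssum R N ^+ 2 / eps ^+ 2 <= Qparam tau eps N.
  by rewrite /Qparam le_max lexx orbT.
apply: (@le_trans _ _ (tau ^+ 2 * Ssum R N ^+ 2 / Qparam tau eps N));
  last first.
  rewrite ler_pdivrMr//; move: hQ; rewrite ler_pdivrMr ?exprn_gt0//; nra.
have -> : tau ^+ 2 * Ssum R N ^+ 2 / Qparam tau eps N =
   \sum_(k < N.-1) Num.sqrt (acoef R N k) *
     (tau ^+ 2 * Ssum R N / Qparam tau eps N).
  by rewrite -mulr_suml -/(Ssum R N); ring.
apply: ler_sum => k _; have a0 := acoef_gt0 R (ltn_ord k).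
have s0 : 0 < Num.sqrt (acoef R N k) by rewrite sqrtr_gt0.
have /andP[hB _] := batch_size_itv tau eps k N1.
have B0 := lt_le_trans _ hB.
rewrite -{1}(sqr_sqrtr (ltW a0)).
set s := Num.sqrt _ in s0 hB B0 *; set S := Ssum R N in S0 hB B0 *.
set Q := Qparam _ _ _ in Q0 hB B0 *; set B := _%:R in hB B0 *.
have q0 : 0 < Q * s / S by rewrite divr_gt0 ?mulr_gt0.
have -> : tau ^+ 2 * S / Q = s * (tau ^+ 2 / (Q * s / S)).
  by field; rewrite !gt_eqF.
rewrite [leRHS]mulrA -expr2 ler_wpM2l ?sqr_ge0// ler_wpM2l ?sqr_ge0//.
by rewrite lef_pV2 ?posrE// B0.
Qed.

(** Before rounding the batch sizes sum to exactly Q; each ceiling adds at most 1. *)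
Lemma oracle_evaluations_le (R : realType) (tau eps : R) (N : nat) :
  (1 < N)%N ->
  (oracle_evaluations N (batch_size tau eps N))%:R
    <= Qparam tau eps N + N.-1%:R :> R.
Proof.
move=> N1; have S0 := Ssum_gt0 R N1; rewrite /oracle_evaluations natr_sum.
apply: (@le_trans _ _ (\sum_(k < N.-1)
    (Qparam tau eps N * Num.sqrt (acoef R N k) / Ssum R N + 1))).
  apply: ler_sum => k _.
  by have /andP[_ /ltW] := batch_size_itv tau eps k N1.
rewrite big_split/= sumr_const card_ord -mulr_suml -mulr_sumr -/(Ssum R N).
by rewrite mulfK// gt_eqF.
Qed.

(** With t = tau^2 / eps^2, the cost is at most Q + (N - 1) <= 2 + 128 t L^2 + 4 D / eps. The
    constant 2 is charged to the 1 in the maximum and the rest to 128 times the complexity, hence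
    130. *)
Lemma oracle_evaluations_complexity (R : realType) (D tau eps : R) :
  0 <= D -> 0 < eps ->
  (oracle_evaluations (horizon D eps)
      (batch_size tau eps (horizon D eps)))%:R
    <= 130 * Num.max 1 (complexity D tau eps).
Proof.
move=> D0 e0; set N := horizon D eps; have N1 : (1 < N)%N := horizon_gt1 D eps.
have hN := horizon_pred_le D0 e0; rewrite -/N in hN.
set de := D / eps; have de0 : 0 <= de by rewrite divr_ge0// ltW.
have hN' : N.-1%:R <= 1 + 4 * de by move: hN; rewrite -mulrA.
set t := tau ^+ 2 / eps ^+ 2; have t0 : 0 <= t by rewrite divr_ge0 ?sqr_ge0.
set L := 1 + ln (1 + de).
have L1 : 1 <= L by rewrite lerDl ln_ge0//; lra.
have S0 := Ssum_gt0 R N1.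
(* N - 1 <= 4 (1 + D / eps), and ln 4 <= 3 is absorbed because L >= 1. Squaring gives 8 * 16 = 128
   below. *)
have SL : Ssum R N <= 4 * L.
  apply: (le_trans (Ssum_le_ln R N1)).
  have : ln N.-1%:R <= ln (4 * (1 + de)).
    by rewrite ler_ln ?posrE ?ltr0n; [lra|lia|lra].
  have : ln (1 + 3) <= 3 :> R by apply: le_ln1Dx; lra.
  rewrite lnM ?posrE; [|lra|lra].
  by rewrite (_ : 1 + 3 = 4 :> R); [rewrite /L in L1 *; lra|lra].
have tL : 0 <= t * L ^+ 2 by rewrite mulr_ge0// sqr_ge0.
have QL : Qparam tau eps N <= 1 + 128 * (t * L ^+ 2).
  rewrite /Qparam ge_max; apply/andP; split; first lra.
  have -> : 8 * tau ^+ 2 * Ssum R N ^+ 2 / eps ^+ 2 = t * (8 * Ssum R N ^+ 2).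
    by rewrite /t; ring.
  have : t * (8 * Ssum R N ^+ 2) <= t * (128 * L ^+ 2).
    by rewrite ler_wpM2l//; nra.
  by lra.
have := oracle_evaluations_le tau eps N1.
have : 1 <= Num.max 1 (complexity D tau eps) by rewrite le_max lexx.
have : complexity D tau eps <= Num.max 1 (complexity D tau eps).
  by rewrite le_max lexx orbT.
rewrite {1}/complexity -/de -/t -/L.
by lra.
Qed.

(** * Borel measurability in R^d *)

Lemma measurable_coord (R : realType) (d : nat) (i : 'I_d) :
  measurable_fun [set: borel_rV R d]
    (fun x : borel_rV R d => (x : 'rV[R]_d) 0 i).
Proof.
apply: (measurability _ (RGenOInfty.measurableE R)) => _ [_ [a ->] <-].
rewrite setTI; apply: sub_sigma_algebra.
have /continuousP/(_ _ (@rray_open _ R a)) := @coord_continuous R 1 d 0 i.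
exact.
Qed.

(* The sup-norm balls with rational centre and radius 1/(n+1) form a countable
   base of the topology. *)
Lemma measurable_fun_rVP (R : realType) (d : nat) (dS : measure_display)
    (S : measurableType dS) (f : S -> borel_rV R d) :
  measurable_fun [set: S] f <->
  forall i, measurable_fun [set: S] (fun s => (f s : 'rV[R]_d) 0 i).
Proof.
split=> [mf i|mf].
  exact: (measurableT_comp (measurable_coord (R := R) (d := d) i) mf).
apply: (@measurability _ _ S (borel_rV R d) setT f (@open 'rV[R]_d)) => //.
move=> _ [U oU <-]; rewrite setTI.
pose box (p : 'rV[rat]_d * nat) : set 'rV[R]_d :=
  [set x | forall i, `|x 0 i - ratr (p.1 0 i)| < p.2.+1%:R^-1].
have -> : f @^-1` U =
    \bigcup_p (if `[< box p `<=` U >] then f @^-1` box p else set0).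
  apply/seteqP; split=> [s /= Us|s [p _]]; last first.
    by case: ifPn => [/asboolP bU|_ []]//; exact: bU.
  have /nbhs_ballP[e /= e0 eU] : nbhs (f s : 'rV[R]_d) U.
    exact: open_nbhs_nbhs.
  (* With half-width below e/2, a box whose centre is that close to [f s] stays inside the e-ball
     around [f s]. *)
  have [n _ /(_ n (leqnn n)) hn] :=
    near_infty_natSinv_lt (PosNum (divr_gt0 e0 (ltr0n R 2))).
  have n0 : 0 < n.+1%:R^-1 :> R by rewrite invr_gt0.
  have /choice[q hq] : forall i : 'I_d, exists q : rat,
      `|(f s : 'rV[R]_d) 0 i - ratr q| < n.+1%:R^-1.
    move=> i; set t := (f s : 'rV[R]_d) 0 i.
    have /rat_in_itvoo[q] : t - n.+1%:R^-1 < t + n.+1%:R^-1.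
      by rewrite ltrD2l gtrN.
    rewrite in_itv/= => /andP[h1 h2]; exists q.
    by move: (_^-1) h1 h2 => r h1 h2; rewrite ltr_norml; lra.
  exists (\row_i q i, n) => //; case: ifPn => [_ i|/asboolPn[]].
    by rewrite /= mxE.
  move=> y hy; apply: eU; refine (conj e0 _) => a b.
  rewrite [a]ord1 /ball/=.
  have := hq b; have := hy b; rewrite /= mxE distrC => h1 h2.
  apply: le_lt_trans (ler_distD (ratr (q b)) _ _) _.
  apply: lt_trans (ltrD h2 h1) _.
  have : n.+1%:R^-1 < e / 2 := hn.
  by move: (_^-1) => r; lra.
apply: countable_bigcupT_measurable => [|p]; first exact: countableP.
case: ifP => // _.
have -> : f @^-1` box p = \bigcap_(i in [set: 'I_d])
    (fun s => (f s : 'rV[R]_d) 0 i) @^-1`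
      ball (ratr (p.1 0 i) : R) p.2.+1%:R^-1.
  apply/seteqP; split=> [s h i _|s h i].
    by have := h i; rewrite /ball/= distrC.
  by have := h i I; rewrite /ball/= distrC.
apply: fin_bigcap_measurable => // i _.
by rewrite -[X in measurable X]setTI; apply: mf => //; exact: measurable_ball.
Qed.

Section measurable_rV_operations.
Context (R : realType) (d : nat) (dS : measure_display) (S : measurableType dS).
Implicit Types f g : S -> borel_rV R d.

Lemma measurable_rVD f g : measurable_fun [set: S] f ->
  measurable_fun [set: S] g ->
  measurable_fun [set: S] (fun s => (f s : 'rV[R]_d) + g s : borel_rV R d).
Proof.
move=> /measurable_fun_rVP mf /measurable_fun_rVP mg.
apply/measurable_fun_rVP => i; under eq_fun => s do rewrite mxE.
exact: measurable_funD.
Qed.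

Lemma measurable_rVZ (a : R) f : measurable_fun [set: S] f ->
  measurable_fun [set: S] (fun s => a *: (f s : 'rV[R]_d) : borel_rV R d).
Proof.
move=> /measurable_fun_rVP mf.
apply/measurable_fun_rVP => i; under eq_fun => s do rewrite mxE.
exact: measurable_funM.
Qed.

Lemma measurable_rVB f g : measurable_fun [set: S] f ->
  measurable_fun [set: S] g ->
  measurable_fun [set: S] (fun s => (f s : 'rV[R]_d) - g s : borel_rV R d).
Proof.
move=> mf mg; apply: measurable_rVD => //.
under eq_fun => s do rewrite -scaleN1r.
exact: measurable_rVZ.
Qed.

Lemma measurable_rV_sum (n : nat) (F : 'I_n -> S -> borel_rV R d) :
  (forall j, measurable_fun [set: S] (F j)) ->
  measurable_fun [set: S]
    (fun s => \sum_(j < n) (F j s : 'rV[R]_d) : borel_rV R d).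
Proof.
move=> mF; apply/measurable_fun_rVP => i.
under eq_fun => s do rewrite summxE.
by apply: measurable_sum => j; have /measurable_fun_rVP := mF j.
Qed.

Lemma measurable_dot f g : measurable_fun [set: S] f ->
  measurable_fun [set: S] g ->
  measurable_fun [set: S] (fun s => dot (f s : 'rV[R]_d) (g s)).
Proof.
move=> /measurable_fun_rVP mf /measurable_fun_rVP mg.
by apply: measurable_sum => i; exact: measurable_funM.
Qed.

Lemma measurable_sqr_enorm f : measurable_fun [set: S] f ->
  measurable_fun [set: S] (fun s => enorm (f s : 'rV[R]_d) ^+ 2).
Proof.
by move=> mf; under eq_fun => s do rewrite -dotxx; exact: measurable_dot.
Qed.

End measurable_rV_operations.

Lemma measurable_nonexpansive (R : realType) (d : nat)
    (T : 'rV[R]_d -> 'rV[R]_d) : nonexpansive T ->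
  measurable_fun [set: borel_rV R d] (T : borel_rV R d -> borel_rV R d).
Proof.
move=> Tne; apply: (@measurability _ _ (borel_rV R d) (borel_rV R d) setT T
  (@open 'rV[R]_d)) => //.
move=> _ [U oU <-]; rewrite setTI; apply: sub_sigma_algebra.
suff /continuousP : continuous T by apply.
move=> x A /nbhs_ballP[e /= e0 eA]; apply/nbhs_ballP.
(* Sup distance below e / (d + 1) gives squared Euclidean distance at most d e^2 / (d + 1)^2 < e^2;
   with d + 1 the radius makes sense for d = 0 too. *)
exists (e / d.+1%:R); first by rewrite /= divr_gt0.
move=> y [_ xy]; apply: eA; refine (conj e0 _) => a i; rewrite [a]ord1 /ball/=.
have d0 : 0 < e / d.+1%:R by rewrite divr_gt0.
rewrite -(@ltr_pXn2r _ 2) ?nnegrE//; last exact: ltW.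
apply: (@le_lt_trans _ _ (enorm (T x - T y) ^+ 2)).
  rewrite sqr_enorm (bigD1 i)//= real_normK ?num_real// !mxE lerDl sumr_ge0//.
  by move=> j _; rewrite sqr_ge0.
apply: (le_lt_trans (nonexpansive_sqr Tne _ _)).
apply: (@le_lt_trans _ _ (\sum_(j < d) (e / d.+1%:R) ^+ 2)).
  rewrite sqr_enorm; apply: ler_sum => j _.
  have := xy 0 j; rewrite /ball/= !mxE -[leLHS]real_normK ?num_real// => /ltW h.
  by rewrite lerXn2r ?nnegrE// ltW.
rewrite sumr_const card_ord -[ltLHS]mulr_natl expr_div_n mulrCA.
rewrite -[ltRHS]mulr1 ltr_pM2l ?exprn_gt0// ltr_pdivrMr ?exprn_gt0// mul1r.
by rewrite -natrX ltr_nat; nia.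
Qed.

(** * Independence of one sample from the others *)

Section fresh_sample.
Context (R : realType) (dO dS dX : measure_display).
Context (Omega : measurableType dO) (S : measurableType dS).
Context (Xi : measurableType dX) (P : probability Omega R).
Context (mu : probability Xi R).

(** One product rule encodes both that z has law [mu] (take A = [setT]) and that z is independent of
    W. *)
Definition fresh_sample (W : Omega -> S) (z : Omega -> Xi) :=
  [/\ measurable_fun [set: Omega] W, measurable_fun [set: Omega] z &
    forall A C, measurable A -> measurable C ->
      P (W @^-1` A `&` z @^-1` C) = (P (W @^-1` A) * mu C)%E].

Variables (W : Omega -> S) (z : Omega -> Xi).
Hypothesis Wz : fresh_sample W z.

Let mW : measurable_fun [set: Omega] W. Proof. by case: Wz. Qed.
Let mz : measurable_fun [set: Omega] z. Proof. by case: Wz. Qed.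
Let Wz2 (w : Omega) := (W w, z w).
Let mWz : measurable_fun [set: Omega] Wz2.
Proof. exact: measurable_fun_pair. Qed.

HB.instance Definition _ := isMeasurableFun.Build _ _ _ _ W mW.
HB.instance Definition _ := isMeasurableFun.Build _ _ _ _
  Wz2 mWz.

Let PW : probability S R := distribution P W.
Let PWz : probability (S * Xi)%type R := distribution P Wz2.

Let fresh_joint_law A : measurable A -> PWz A = (PW \x mu)%E A.
Proof.
move=> mA; apply/esym; apply: product_measure_unique => // B C mB mC.
by have [_ _ /(_ _ _ mB mC)] := Wz.
Qed.

Lemma fresh_ge0_integral (f : S * Xi -> \bar R) :
  measurable_fun [set: S * Xi] f -> (forall p, 0 <= f p)%E ->
  (\int[P]_w f (W w, z w) = \int[P]_w \int[mu]_y f (W w, y))%E.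
Proof.
move=> mf f0.
rewrite -[LHS](ge0_integral_distribution Wz2)//.
rewrite (eq_measure_integral (PW \x mu)%E); last first.
  by move=> A mA _; exact: fresh_joint_law.
rewrite fubini_tonelli1// (ge0_integral_distribution W)//.
  exact: measurable_fun_fubini_tonelli_F.
by move=> s; apply: integral_ge0.
Qed.

Lemma fresh_integral (f : S * Xi -> \bar R) :
  measurable_fun [set: S * Xi] f ->
  P.-integrable setT (fun w => f (W w, z w)) ->
  (\int[P]_w f (W w, z w) = \int[P]_w \int[mu]_y f (W w, y))%E.
Proof.
move=> mf If.
(* Fubini's theorem needs integrability under the product law; it follows from the nonnegative case
   applied to |f|. *)
have Ip : (PW \x mu)%E.-integrable setT f.
  apply/integrableP; split=> //.
  rewrite fubini_tonelli1//; last exact: measurableT_comp.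
  rewrite [ltLHS](ge0_integral_distribution W)//; last 2 first.
  - by apply: measurable_fun_fubini_tonelli_F => //; exact: measurableT_comp.
  - by move=> s; apply: integral_ge0.
  rewrite -(fresh_ge0_integral (f := abse \o f))//.
  - by have /integrableP[] := If.
  - exact: measurableT_comp.
  - by move=> p; exact: abse_ge0.
rewrite -[LHS](@integral_distribution _ _ _ _ _ P Wz2)//.
rewrite (eq_measure_integral (PW \x mu)%E); last first.
  by move=> A mA _; exact: fresh_joint_law.
rewrite -integral12_prod_meas1// (@integral_distribution _ _ _ _ _ P W)//.
- exact: (measurable_fubini_F Ip).
- have /integrableP[mF oF] := integrable_fubini_F Ip.
  apply/integrableP; split; first exact: (measurableT_comp mF mW).
  move: oF; rewrite (ge0_integral_distribution W)//.
  exact: measurableT_comp.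
Qed.

End fresh_sample.

(** * Product law of the samples, and the sigma-algebra of all samples but one *)

Section sample_cylinders.
Context (R : realType) (dO dX : measure_display) (Omega : measurableType dO).
Context (Xi : measurableType dX) (P : probability Omega R).
Context (mu : probability Xi R) (n : nat) (B : nat -> nat).
Context (xi : nat -> nat -> {RV P >-> Xi}).
Hypothesis xi_law : forall k j, (k < n)%N -> (j < B k)%N ->
  forall A, measurable A -> distribution P (xi k j) A = mu A.
Hypothesis xi_indep : independent_minibatches n B xi.

Implicit Types A : nat -> nat -> set Xi.

Definition cylinder A : set Omega :=
  \big[setI/setT]_(k < n) \big[setI/setT]_(j < B k) (xi k j @^-1` A k j).

(** A pi-system generating the sigma-algebra of all samples except [xi k0 j0], on which no
    constraint is put. *)
Definition others_cylinders (k0 j0 : nat) : set (set Omega) :=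
  [set cylinder A | A in
    [set A | (forall k j, measurable (A k j)) /\ A k0 j0 = setT]].

Lemma measurable_sample k j C : measurable C -> measurable (xi k j @^-1` C).
Proof.
by move=> mC; rewrite -[X in measurable X]setTI; exact: measurable_funPT.
Qed.

Lemma measurable_cylinder A : (forall k j, measurable (A k j)) ->
  measurable (cylinder A).
Proof.
move=> mA; do 2!apply: bigsetI_measurable => ? _.
exact: measurable_sample.
Qed.

(** Independence is used twice: across batches, since each inner intersection lies in the
    sigma-algebra of its batch, then within each batch. *)
Lemma probability_cylinder A : (forall k j, measurable (A k j)) ->
  (P (cylinder A) = \prod_(k < n) \prod_(j < B k) mu (A k j))%E.
Proof.
move=> mA; have [ind_in ind_out] := xi_indep.
rewrite /cylinder.
rewrite (ind_out _ (index_enum_uniq _)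
  (fun k => \big[setI/setT]_(j < B k) (xi k j @^-1` A k j))); last first.
  move=> k _; rewrite /g_sigma_preimage.
  set G := \big[setU/set0]_(_ < _) _.
  apply: (@bigsetI_measurable _ (g_sigma_algebraType G)) => j _.
  apply: sub_sigma_algebra; rewrite /G -bigcup_seq.
  exists j; first by rewrite /= mem_index_enum.
  by exists (A k j) => //; rewrite setTI.
apply: eq_bigr => k _.
rewrite (ind_in _ (ltn_ord k) _ (index_enum_uniq _)
  (fun j => xi k j @^-1` A k j)); last first.
  by move=> j _; exists (A k j) => //; rewrite setTI.
by apply: eq_bigr => j _; rewrite -(xi_law (ltn_ord k) (ltn_ord j)).
Qed.

Lemma cylinderI A A' :
  cylinder A `&` cylinder A' = cylinder (fun k j => A k j `&` A' k j).
Proof.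
by rewrite /cylinder -big_split/=; apply: eq_bigr => k _; rewrite -big_split.
Qed.

Lemma cylinderT : cylinder (fun _ _ => setT) = setT.
Proof. by rewrite /cylinder big1// => k _; rewrite big1. Qed.

Definition at_sample (k0 j0 : nat) (C : set Xi) : nat -> nat -> set Xi :=
  fun k j => if (k == k0) && (j == j0) then C else setT.

Lemma cylinder_at_sample k0 j0 C : (k0 < n)%N -> (j0 < B k0)%N ->
  cylinder (at_sample k0 j0 C) = xi k0 j0 @^-1` C.
Proof.
move=> k0n j0B; rewrite /cylinder (bigD1 (Ordinal k0n))//=.
rewrite (bigD1 (Ordinal j0B))//=.
rewrite big1 ?setIT; last first.
  move=> j; rewrite -val_eqE/= => /negbTE jj0.
  by rewrite /at_sample jj0 andbF.
rewrite big1 ?setIT /at_sample ?eqxx//.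
move=> k; rewrite -val_eqE/= => /negbTE kk0.
by rewrite big1// => j _; rewrite kk0.
Qed.

Section one_sample.
Variables (k0 j0 : nat).
Hypotheses (k0n : (k0 < n)%N) (j0B : (j0 < B k0)%N).

(** The intersection is again a cylinder; in the product formula only the factor at (k0, j0)
    changes, from [mu setT] = 1 to [mu C]. *)
Lemma probability_cylinder_at_sample A C : (forall k j, measurable (A k j)) ->
  A k0 j0 = setT -> measurable C ->
  (P (cylinder A `&` xi k0 j0 @^-1` C) = P (cylinder A) * mu C)%E.
Proof.
move=> mA A0 mC; rewrite -(cylinder_at_sample _ k0n j0B) cylinderI.
rewrite !probability_cylinder//; last first.
  by move=> k j; apply: measurableI => //; rewrite /at_sample; case: ifP.
rewrite (bigD1 (Ordinal k0n))//= (bigD1 (Ordinal j0B))//=.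
rewrite [in RHS](bigD1 (Ordinal k0n))//= [in RHS](bigD1 (Ordinal j0B))//=.
rewrite A0 setTI probability_setT mul1e {1}/at_sample !eqxx/=.
rewrite [RHS]muleC muleA; congr (_ * _ * _)%E.
  apply: eq_bigr => j; rewrite -val_eqE/= => /negbTE jj0.
  by rewrite /at_sample jj0 andbF setIT.
apply: eq_bigr => k; rewrite -val_eqE/= => /negbTE kk0.
by apply: eq_bigr => j _; rewrite /at_sample kk0 setIT.
Qed.

(** The identity into Omega with this coarser sigma-algebra plays the role of the collection of all
    other samples. *)
Lemma measurable_others_id :
  measurable_fun [set: Omega]
    (id : Omega -> g_sigma_algebraType (others_cylinders k0 j0)).
Proof.
apply: (@measurability _ _ Omega (g_sigma_algebraType (others_cylinders k0 j0))
  setT _ (others_cylinders k0 j0)) => //.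
by move=> _ [_ [A [mA _] <-] <-]; rewrite setTI; exact: measurable_cylinder.
Qed.

Lemma measurable_other_sample k j : (k, j) != (k0, j0) ->
  (k < n)%N -> (j < B k)%N ->
  measurable_fun [set: g_sigma_algebraType (others_cylinders k0 j0)]
    (xi k j : g_sigma_algebraType (others_cylinders k0 j0) -> Xi).
Proof.
move=> neq kn jB _ C mC; rewrite setTI; apply: sub_sigma_algebra.
exists (at_sample k j C); last exact: cylinder_at_sample.
split=> [k' j'|]; rewrite /at_sample; first by case: ifP.
by rewrite ifN// -xpair_eqE eq_sym.
Qed.

(** For fixed C, both sides are finite measures in A: P restricted to the event that the sample lies
    in C, and P scaled by [mu C]. They agree on the pi-system of cylinders, hence on the
    sigma-algebra it generates. *)
Lemma fresh_sample_others :
  fresh_sample P mu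
    (id : Omega -> g_sigma_algebraType (others_cylinders k0 j0)) (xi k0 j0).
Proof.
split; [exact: measurable_others_id|exact: measurable_funPT|].
move=> A C mA mC; rewrite preimage_id.
pose Cz := xi k0 j0 @^-1` C.
have mCz : measurable Cz by exact: measurable_sample.
pose c : {nonneg R} := NngNum (fine_ge0 (measure_ge0 mu C)).
have muC : mu C = (c%:num)%:E by rewrite /= fineK// fin_num_measure.
rewrite muC muleC.
apply: (@g_sigma_algebra_measure_unique _ _ _ (others_cylinders k0 j0)
  _ (fun=> setT) _ _ (mrestr P mCz) (mscale c P)) => //.
- by move=> _ [A' [mA' _] <-]; exact: measurable_cylinder.
- by move=> _; exists (fun _ _ => setT); [split|exact: cylinderT].
- by rewrite bigcup_const.
- move=> _ _ [A1 [mA1 A10] <-] [A2 [mA2 A20] <-]; rewrite cylinderI.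
  exists (fun k j => A1 k j `&` A2 k j) => //; split=> [k j|].
    exact: measurableI.
  by rewrite A10 A20 setIT.
- move=> _ [A' [mA' A'0] <-].
  rewrite [RHS](_ : _ = (c%:num)%:E * P (cylinder A'))%E// -muC muleC.
  exact: probability_cylinder_at_sample.
- move=> _; rewrite [ltLHS](_ : _ = P Cz) ?ltey_eq ?fin_num_measure//.
  by rewrite -[in RHS](setTI Cz).
Qed.

End one_sample.

End sample_cylinders.

(** * Moments of the mini-batch maps *)

Section mean_le.
Context (R : realType) (dO : measure_display) (Omega : measurableType dO).
Context (P : probability Omega R).
Implicit Types (f g : Omega -> R) (c : R).

(** Integrability is bundled with the bound so that bounds can be added even for signed functions
    such as the cross terms. *)
Definition mean_le f c :=
  P.-integrable setT (EFin \o f) /\ (\int[P]_w (f w)%:E <= c%:E)%E.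

Lemma mean_le_ge0 f c : measurable_fun [set: Omega] f -> (forall w, 0 <= f w) ->
  (\int[P]_w (f w)%:E <= c%:E)%E -> mean_le f c.
Proof.
move=> mf f0 fc; split=> //; apply/integrableP; split.
  exact/measurable_EFinP.
under eq_integral => w _ do rewrite /= ger0_norm//.
exact: le_lt_trans fc (ltry _).
Qed.

Lemma mean_le_cst c : mean_le (fun=> c) c.
Proof.
have e : (\int[P]__ c%:E = c%:E)%E.
  by rewrite integral_cst//= probability_setT mule1.
split; last by rewrite e.
apply/integrableP; split; first exact: measurable_cst.
by rewrite /= integral_cst//= probability_setT mule1 ltry.
Qed.

Lemma mean_leD f g c c' : mean_le f c -> mean_le g c' ->
  mean_le (fun w => f w + g w) (c + c').
Proof.
move=> [If fc] [Ig gc]; split; first exact: (integrableD measurableT If Ig).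
by rewrite (integralD_EFin measurableT If Ig) EFinD leeD.
Qed.

Lemma mean_leZ (a : R) f c : 0 <= a -> mean_le f c ->
  mean_le (fun w => a * f w) (a * c).
Proof.
move=> a0 [If fc]; split; first exact: (integrableZl measurableT a If).
rewrite (integralZl measurableT If) EFinM.
exact: lee_wpmul2l.
Qed.

Lemma mean_le_sum (n : nat) (F : 'I_n -> Omega -> R) (C : 'I_n -> R) :
  (forall i, mean_le (F i) (C i)) ->
  mean_le (fun w => \sum_(i < n) F i w) (\sum_(i < n) C i).
Proof.
elim: n F C => [|n IHn] F C h.
  rewrite big_ord0; under eq_fun => w do rewrite big_ord0.
  exact: mean_le_cst.
rewrite big_ord_recl; under eq_fun => w do rewrite big_ord_recl.
exact/mean_leD/IHn.
Qed.

Lemma mean_le_dominated f g c : measurable_fun [set: Omega] g ->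
  (forall w, 0 <= g w <= f w) -> mean_le f c -> mean_le g c.
Proof.
move=> mg gf [If fc].
have g0 w : 0 <= g w by case/andP: (gf w).
have gf' w : g w <= f w by case/andP: (gf w).
have Ig : P.-integrable setT (EFin \o g).
  apply: (le_integrable measurableT _ _ If); first exact/measurable_EFinP.
  by move=> w _ /=; rewrite lee_fin !ger0_norm// (le_trans (g0 w)).
split=> //; apply: le_trans fc; apply: le_integral => // w _.
by rewrite lee_fin.
Qed.

Lemma mean_leW f c c' : c <= c' -> mean_le f c -> mean_le f c'.
Proof. by move=> cc' [If fc]; split=> //; rewrite (le_trans fc)// lee_fin. Qed.

End mean_le.

(** * Square-integrable random vectors *)

Section square_integrable.
Context (R : realType) (d : nat) (dO : measure_display).
Context (Omega : measurableType dO) (P : probability Omega R).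
Implicit Types X Y : Omega -> borel_rV R d.

Definition square_integrable X :=
  measurable_fun [set: Omega] X /\
  exists c, mean_le P (fun w => enorm (X w : 'rV[R]_d) ^+ 2) c.

Lemma square_integrable_cst (x : 'rV[R]_d) :
  square_integrable (fun=> x : borel_rV R d).
Proof. by split=> //; exists (enorm x ^+ 2); exact: mean_le_cst. Qed.

Lemma square_integrableD X Y : square_integrable X -> square_integrable Y ->
  square_integrable (fun w => (X w : 'rV[R]_d) + Y w : borel_rV R d).
Proof.
move=> [mX [c Xc]] [mY [c' Yc]].
have mD := measurable_rVD mX mY; split=> //.
exists (2 * c + 2 * c').
apply: (@mean_le_dominated _ _ _ _
  (fun w => 2 * enorm (X w : 'rV[R]_d) ^+ 2 + 2 * enorm (Y w : 'rV[R]_d) ^+ 2)).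
- exact: measurable_sqr_enorm.
- move=> w; rewrite sqr_ge0 sqr_enormD/=.
  have := @dot_young _ _ 1 (X w) (Y w) ltr01; rewrite mul1r divr1; lra.
- by apply: mean_leD; exact: mean_leZ.
Qed.

Lemma square_integrableZ (a : R) X : square_integrable X ->
  square_integrable (fun w => a *: (X w : 'rV[R]_d) : borel_rV R d).
Proof.
move=> [mX [c Xc]]; split; first exact: measurable_rVZ.
exists (a ^+ 2 * c).
under eq_fun => w do rewrite -dotxx dotZr dotC dotZr dotxx mulrA -expr2.
by apply: mean_leZ => //; exact: sqr_ge0.
Qed.

Lemma square_integrableB X Y : square_integrable X -> square_integrable Y ->
  square_integrable (fun w => (X w : 'rV[R]_d) - Y w : borel_rV R d).
Proof.
move=> sX sY; apply: square_integrableD => //.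
under eq_fun => w do rewrite -scaleN1r.
exact: square_integrableZ.
Qed.

(** The fixed point anchors T: |T X - xs| <= |X - xs|, and adding the constant xs keeps square
    integrability. *)
Lemma square_integrable_nonexpansive (T : 'rV[R]_d -> 'rV[R]_d)
    (xs : 'rV[R]_d) X : nonexpansive T -> T xs = xs -> square_integrable X ->
  square_integrable (fun w => T (X w) : borel_rV R d).
Proof.
move=> Tne Txs sX.
have mT : measurable_fun [set: Omega] (fun w => T (X w) : borel_rV R d).
  exact: (measurableT_comp (measurable_nonexpansive Tne) sX.1).
have [mX' [c Xc]] := square_integrableB sX (square_integrable_cst xs).
have sT : square_integrable (fun w => T (X w) - xs : borel_rV R d).
  have m : measurable_fun [set: Omega] (fun w => T (X w) - xs : borel_rV R d).
    exact: measurable_rVB.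
  split=> //; exists c; apply: mean_le_dominated Xc.
    exact: measurable_sqr_enorm.
  by move=> w; rewrite sqr_ge0 -[in leLHS]Txs nonexpansive_sqr.
have := square_integrableD sT (square_integrable_cst xs).
by under eq_fun => w do rewrite subrK.
Qed.

Lemma integrable_dot X Y : square_integrable X -> square_integrable Y ->
  P.-integrable setT (fun w => (dot (X w : 'rV[R]_d) (Y w))%:E).
Proof.
move=> [mX [c Xc]] [mY [c' Yc]].
have [If _] := mean_leD Xc Yc.
apply: (le_integrable measurableT _ _ If).
  by apply/measurable_EFinP; exact: measurable_dot.
move=> w _ /=; rewrite lee_fin [leRHS]ger0_norm ?addr_ge0 ?sqr_ge0//.
(* Young's inequality for Y and for -Y bounds the inner product from both sides. *)
have := @dot_young _ _ 1 (X w) (Y w) ltr01.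
have := @dot_young _ _ 1 (X w) (- Y w : 'rV[R]_d) ltr01.
rewrite -[- Y w]scaleN1r dotZr mulN1r.
have -> : enorm (-1 *: (Y w : 'rV[R]_d)) ^+ 2 = enorm (Y w : 'rV[R]_d) ^+ 2.
  by rewrite -dotxx dotZr dotC dotZr mulN1r mulN1r opprK dotxx.
have := sqr_ge0 (enorm (X w : 'rV[R]_d)).
have := sqr_ge0 (enorm (Y w : 'rV[R]_d)).
by rewrite ler_norml mul1r divr1; lra.
Qed.

End square_integrable.

(** * Oracle noise at random points and its mini-batch average *)

Section oracle_moments.
Context (R : realType) (d : nat) (dX : measure_display).
Context (Xi : measurableType dX) (mu : probability Xi R).
Variable T : 'rV[R]_d -> 'rV[R]_d.
Variables (To : 'rV[R]_d -> Xi -> 'rV[R]_d) (tau : R).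
Hypothesis Tne : nonexpansive T.
Hypothesis mTo : jointly_measurable To.
Hypothesis To_mean :
  forall y i, ('E_mu[fun z => (To y z 0 i)%R] = ((T y 0 i)%R)%:E)%E.
Hypothesis To_var :
  forall y, ('E_mu[fun z => (enorm (To y z - T y) ^+ 2)%R]
     <= ((tau ^+ 2)%R)%:E)%E.
Hypothesis To_lip :
  forall y y', ('E_mu[fun z => (enorm (To y z - To y' z) ^+ 2)%R]
     <= ((enorm (y - y') ^+ 2)%R)%:E)%E.

Lemma measurable_oracle (dS : measure_display) (S : measurableType dS)
    (X : S -> borel_rV R d) (z : S -> Xi) :
  measurable_fun [set: S] X -> measurable_fun [set: S] z ->
  measurable_fun [set: S] (fun s => To (X s) (z s) : borel_rV R d).
Proof.
move=> mX mz.
exact: (measurableT_comp mTo (measurable_fun_pair mX mz)).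
Qed.

Lemma measurable_exact (dS : measure_display) (S : measurableType dS)
    (X : S -> borel_rV R d) : measurable_fun [set: S] X ->
  measurable_fun [set: S] (fun s => T (X s) : borel_rV R d).
Proof. exact: measurableT_comp (measurable_nonexpansive Tne). Qed.

Let noise (y : 'rV[R]_d) (z : Xi) : borel_rV R d := To y z - T y.

Lemma square_integrable_oracle_noise y : square_integrable mu (noise y).
Proof.
have m : measurable_fun [set: Xi] (noise y).
  by apply: measurable_rVB => //; exact: measurable_oracle.
split=> //; exists (tau ^+ 2); apply: mean_le_ge0.
- exact: measurable_sqr_enorm.
- by move=> z; exact: sqr_ge0.
- by have := To_var y; rewrite expectation.unlock.
Qed.

Lemma integral_dot_oracle_noise y (v : 'rV[R]_d) :
  (\int[mu]_z (dot (To y z - T y) v)%:E = 0)%E.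
Proof.
(* A coordinate is an inner product with a basis vector, so its integrability is a case of
   [integrable_dot]. *)
have delta i : dot (delta_mx 0 i : 'rV[R]_d) =1 (fun u => u 0 i).
  move=> u; rewrite /dot (bigD1 i)//= mxE !eqxx mul1r big1 ?addr0// => j ji.
  by rewrite mxE eqxx (negbTE ji) mul0r.
have int_coord i : mu.-integrable setT (fun z => (noise y z 0 i)%:E).
  have := integrable_dot (square_integrable_oracle_noise y)
    (square_integrable_cst mu (delta_mx 0 i)).
  by under eq_fun => z do rewrite dotC delta.
under eq_integral => z _.
  rewrite /dot -sumEFin.
  over.
rewrite /= integral_sum//; last first.
  move=> i; have := integrableZl measurableT (v 0 i) (int_coord i).
  by under eq_fun => z do rewrite -EFinM mulrC.
rewrite big1// => i _.
under eq_integral => z _ do rewrite mulrC EFinM.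
rewrite integralZl//.
suff -> : (\int[mu]_z (noise y z 0 i)%:E = 0)%E by rewrite mule0.
have IT : mu.-integrable setT (fun z => (To y z 0 i)%:E).
  have [h _] := mean_le_cst mu (T y 0 i).
  have := integrableD measurableT (int_coord i) h.
  apply: eq_integrable => // z _ /=.
  by rewrite -EFinD /noise !mxE subrK.
have [h _] := mean_le_cst mu (T y 0 i).
under eq_integral => z _ do rewrite /noise !mxE EFinB.
rewrite (integralB_EFin measurableT IT h).
have := To_mean y i; rewrite expectation.unlock => ->.
by rewrite integral_cst//= probability_setT mule1 subee.
Qed.

Section fresh_oracle.
Context (dO dS : measure_display) (Omega : measurableType dO).
Context (S : measurableType dS) (P : probability Omega R).
Variables (W : Omega -> S) (z : Omega -> Xi).
Hypothesis Wz : fresh_sample P mu W z.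
Variables X X' : S -> borel_rV R d.
Hypothesis mX : measurable_fun [set: S] X.
Hypothesis mX' : measurable_fun [set: S] X'.

Let mW : measurable_fun [set: Omega] W. Proof. by case: Wz. Qed.
Let mz : measurable_fun [set: Omega] z. Proof. by case: Wz. Qed.

(** The points depend on W only, so by Tonelli's theorem the fresh sample is integrated first with
    the points frozen, where the hypothesis on deterministic points applies. The variance bound
    below uses the same device. *)
Lemma fresh_oracle_lip c :
  mean_le P (fun w => enorm (X (W w) - X' (W w) : 'rV[R]_d) ^+ 2) c ->
  mean_le P
    (fun w => enorm (To (X (W w)) (z w) - To (X' (W w)) (z w)) ^+ 2) c.
Proof.
move=> [_ Xc].
have mf : measurable_fun [set: S * Xi] (fun p =>
    (enorm (To (X p.1) p.2 - To (X' p.1) p.2) ^+ 2)%:E).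
  apply/measurable_EFinP/measurable_sqr_enorm/measurable_rVB;
    by apply: measurable_oracle => //; exact: measurableT_comp.
apply: mean_le_ge0.
- apply/measurable_sqr_enorm/measurable_rVB;
    by apply: measurable_oracle => //; exact: measurableT_comp.
- by move=> w; exact: sqr_ge0.
- rewrite (fresh_ge0_integral Wz mf); last by move=> p; rewrite lee_fin sqr_ge0.
  apply: le_trans Xc; apply: ge0_le_integral => //.
  + by move=> w _; apply: integral_ge0 => y _; rewrite lee_fin sqr_ge0.
  + refine (measurableT_comp (measurable_fun_fubini_tonelli_F (m2 := mu) _ mf _)
      mW) => p.
    by rewrite lee_fin sqr_ge0.
  + apply/measurable_EFinP/measurable_sqr_enorm/measurable_rVB;
      exact: measurableT_comp.
  + move=> w _; have := To_lip (X (W w)) (X' (W w)).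
    by rewrite expectation.unlock.
Qed.

Lemma fresh_oracle_var :
  mean_le P (fun w => enorm (To (X (W w)) (z w) - T (X (W w))) ^+ 2)
    (tau ^+ 2).
Proof.
have mf : measurable_fun [set: S * Xi] (fun p =>
    (enorm (To (X p.1) p.2 - T (X p.1)) ^+ 2)%:E).
  apply/measurable_EFinP/measurable_sqr_enorm/measurable_rVB.
    by apply: measurable_oracle => //; exact: measurableT_comp.
  by apply: measurable_exact; exact: measurableT_comp.
apply: mean_le_ge0.
- apply/measurable_sqr_enorm/measurable_rVB.
    by apply: measurable_oracle => //; exact: measurableT_comp.
  by apply: measurable_exact; exact: measurableT_comp.
- by move=> w; exact: sqr_ge0.
- rewrite (fresh_ge0_integral Wz mf); last by move=> p; rewrite lee_fin sqr_ge0.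
  have [_] := mean_le_cst P (tau ^+ 2); apply: le_trans.
  apply: ge0_le_integral => //.
  + by move=> w _; apply: integral_ge0 => y _; rewrite lee_fin sqr_ge0.
  + refine (measurableT_comp (measurable_fun_fubini_tonelli_F (m2 := mu) _ mf _)
      mW) => p.
    by rewrite lee_fin sqr_ge0.
  + move=> w _; have := To_var (X (W w)).
    by rewrite expectation.unlock.
Qed.

(** With W frozen the noise has mean zero against a fixed vector. The integrand is signed, so square
    integrability is what permits the exchange of integrals. *)
Lemma fresh_oracle_cross : square_integrable P (X' \o W) ->
  mean_le P (fun w => dot (To (X (W w)) (z w) - T (X (W w))) (X' (W w))) 0.
Proof.
move=> sX'.
have sN : square_integrable P
    (fun w => To (X (W w)) (z w) - T (X (W w)) : borel_rV R d).
  split; last by exists (tau ^+ 2); exact: fresh_oracle_var.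
  apply/measurable_rVB.
    by apply: measurable_oracle => //; exact: measurableT_comp.
  by apply: measurable_exact; exact: measurableT_comp.
have I := integrable_dot sN sX'; split=> //.
have mf : measurable_fun [set: S * Xi] (fun p =>
    (dot (To (X p.1) p.2 - T (X p.1)) (X' p.1))%:E).
  apply/measurable_EFinP/measurable_dot; last exact: measurableT_comp.
  apply/measurable_rVB.
    by apply: measurable_oracle => //; exact: measurableT_comp.
  by apply: measurable_exact; exact: measurableT_comp.
rewrite (fresh_integral Wz mf I).
by rewrite integral0_eq// => w _;
  exact: (integral_dot_oracle_noise (X (W w)) (X' (W w))).
Qed.

End fresh_oracle.

Section minibatch_moments.
Context (dO : measure_display) (Omega : measurableType dO).
Context (P : probability Omega R) (b : nat).
Variables (G : nat -> set (set Omega)) (z : nat -> Omega -> Xi).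
Hypothesis b_gt0 : (0 < b)%N.
Hypothesis fresh_z : forall j, (j < b)%N ->
  fresh_sample P mu (id : Omega -> g_sigma_algebraType (G j)) (z j).
Hypothesis mz : forall j l, (j < b)%N -> (l < b)%N -> l != j ->
  measurable_fun [set: g_sigma_algebraType (G j)]
    (z l : g_sigma_algebraType (G j) -> Xi).

(** Here [G j] stands for the information in everything but sample j, so each sample of the batch is
    fresh relative to X. *)
Definition batch_measurable (X : Omega -> 'rV[R]_d) :=
  forall j, (j < b)%N -> measurable_fun [set: g_sigma_algebraType (G j)]
    (X : g_sigma_algebraType (G j) -> borel_rV R d).

Let batch X w := minibatch To b (fun j => z j w) (X w).

Let mzO l : (l < b)%N -> measurable_fun [set: Omega] (z l).
Proof. by move=> lb; have [] := fresh_z lb. Qed.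

Lemma batch_measurable_ambient X : batch_measurable X ->
  measurable_fun [set: Omega] (X : Omega -> borel_rV R d).
Proof.
move=> mX; have [mid _ _] := fresh_z b_gt0.
exact: measurableT_comp (mX _ b_gt0) mid.
Qed.

Lemma measurable_minibatch (dS : measure_display) (S : measurableType dS)
    (X : S -> borel_rV R d) (y : nat -> S -> Xi) :
  measurable_fun [set: S] X ->
  (forall j, (j < b)%N -> measurable_fun [set: S] (y j)) ->
  measurable_fun [set: S]
    (fun s => minibatch To b (fun j => y j s) (X s) : borel_rV R d).
Proof.
move=> mX my; apply: measurable_rVZ.
apply: (measurable_rV_sum (F := fun j s => To (X s) (y j s))) => j.
by apply: measurable_oracle => //; exact: my.
Qed.

(** Jensen's inequality with equal weights 1/b reduces the average to single samples. *)
Lemma minibatch_lip X X' c : batch_measurable X -> batch_measurable X' ->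
  mean_le P (fun w => enorm (X w - X' w) ^+ 2) c ->
  mean_le P (fun w => enorm (batch X w - batch X' w) ^+ 2) c.
Proof.
move=> mX mX' XX'.
have -> : c = \sum_(j < b) b%:R^-1 * c.
  rewrite sumr_const card_ord -mulrnAl -[X in X * c]mulr_natl divff ?mul1r//.
  by rewrite pnatr_eq0 -lt0n.
apply: (@mean_le_dominated _ _ _ _ (fun w => \sum_(j < b) b%:R^-1 *
    enorm (To (X w) (z j w) - To (X' w) (z j w)) ^+ 2)).
- apply/measurable_sqr_enorm/measurable_rVB;
    by apply: measurable_minibatch => //; exact: batch_measurable_ambient.
- move=> w; rewrite sqr_ge0/= /batch /minibatch -scalerBr -sumrB scaler_sumr.
  apply: sqr_enorm_convex => [j|]; first by rewrite invr_ge0.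
  rewrite sumr_const card_ord -[leLHS]mulr_natl divff//.
  by rewrite pnatr_eq0 -lt0n.
- apply: mean_le_sum => j; apply: mean_leZ; first by rewrite invr_ge0.
  have jb := ltn_ord j.
  exact: (fresh_oracle_lip (fresh_z jb) (mX _ jb) (mX' _ jb)).
Qed.

Lemma minibatch_noiseE X w : batch X w - T (X w) =
  b%:R^-1 *: \sum_(j < b) (To (X w) (z j w) - T (X w)).
Proof.
rewrite sumrB sumr_const card_ord scalerBr; congr (_ - _).
by rewrite -[T _ *+ b]scaler_nat scalerA mulVf ?scale1r// pnatr_eq0 -lt0n.
Qed.

Lemma minibatch_cross X Z : batch_measurable X -> batch_measurable Z ->
  square_integrable P (Z : Omega -> borel_rV R d) ->
  mean_le P (fun w => dot (batch X w - T (X w)) (Z w)) 0.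
Proof.
move=> mX mZ sZ.
have -> : (fun w => dot (batch X w - T (X w)) (Z w)) =
    (fun w => \sum_(j < b) b%:R^-1 * dot (To (X w) (z j w) - T (X w)) (Z w)).
  apply/funext => w; rewrite minibatch_noiseE dotC dotZr.
  under [RHS]eq_bigr => j _ do rewrite dotC.
  by rewrite -!mulr_sumr dot_sumr.
apply: (@mean_leW _ _ _ _ _ (\sum_(j < b) b%:R^-1 * 0)).
  by rewrite big1// => j _; rewrite mulr0.
apply: mean_le_sum => j; apply: mean_leZ; first by rewrite invr_ge0.
have jb := ltn_ord j.
exact: (fresh_oracle_cross (fresh_z jb) (mX _ jb) (mZ _ jb)).
Qed.

(* Each new summand is orthogonal in mean to the sum of the previous ones. *)
Lemma minibatch_var X : batch_measurable X ->
  mean_le P (fun w => enorm (batch X w - T (X w)) ^+ 2) (tau ^+ 2 / b%:R).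
Proof.
move=> mX.
have mXO := batch_measurable_ambient mX.
have b0 : b%:R != 0 :> R by rewrite pnatr_eq0 -lt0n.
pose Sm m w := \sum_(j < m) (To (X w) (z j w) - T (X w)).
suff /(_ b (leqnn b)) h : forall m, (m <= b)%N ->
    mean_le P (fun w => enorm (Sm m w) ^+ 2) (m%:R * tau ^+ 2).
  have -> : tau ^+ 2 / b%:R = b%:R^-1 ^+ 2 * (b%:R * tau ^+ 2) by field.
  under eq_fun => w.
    rewrite minibatch_noiseE -dotxx dotZr dotC dotZr dotxx mulrA -expr2.
    over.
  by apply: mean_leZ => //; exact: sqr_ge0.
elim=> [|m IHm] mb.
  rewrite mul0r; have := mean_le_cst P (0 : R).
  congr mean_le; apply/funext => w; rewrite /Sm big_ord0 sqr_enorm big1// => i _.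
  by rewrite mxE expr0n.
have {}IHm := IHm (ltnW mb).
(* The source space is left general because the partial sum must be measurable both for [G m], to be
   orthogonal to the next noise term, and on Omega. *)
have mS (dS : measure_display) (S : measurableType dS)
    (Y : S -> borel_rV R d) (y : nat -> S -> Xi) :
    measurable_fun [set: S] Y ->
    (forall j, (j < m)%N -> measurable_fun [set: S] (y j)) ->
    measurable_fun [set: S]
      (fun s => \sum_(j < m) (To (Y s) (y j s) - T (Y s)) : borel_rV R d).
  move=> mY my.
  apply: (measurable_rV_sum (F := fun j s => To (Y s) (y j s) - T (Y s))) => j.
  apply: measurable_rVB; last exact: measurable_exact.
  by apply: measurable_oracle => //; exact: my.
have cross : mean_le P (fun w =>
    dot (To (X w) (z m w) - T (X w)) (Sm m w)) 0.
  apply: (fresh_oracle_cross (fresh_z mb) (mX _ mb) (X' := Sm m)).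
    apply: mS; first exact: mX.
    move=> j jm; apply: mz => //; first exact: ltn_trans mb.
    by rewrite ltn_eqF.
  split; last by exists (m%:R * tau ^+ 2).
  by apply: mS => // j jm; apply: mzO; exact: ltn_trans mb.
have var := fresh_oracle_var (fresh_z mb) (mX _ mb).
have -> : (fun w => enorm (Sm m.+1 w) ^+ 2) = (fun w => enorm (Sm m w) ^+ 2 +
    2 * dot (To (X w) (z m w) - T (X w)) (Sm m w) +
    enorm (To (X w) (z m w) - T (X w)) ^+ 2).
  by apply/funext => w; rewrite /Sm big_ord_recr/= [LHS]sqr_enormD dotC.
have -> : m.+1%:R * tau ^+ 2 = m%:R * tau ^+ 2 + 2 * 0 + tau ^+ 2 :> R.
  by rewrite -[m.+1]addn1 natrD; ring.
by apply: mean_leD => //; apply: mean_leD => //; exact: mean_leZ.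
Qed.

End minibatch_moments.

End oracle_moments.

(** * The stochastic path *)

Section dual_path.
Context (R : realType) (d N : nat) (x0 : 'rV[R]_d).
Implicit Types V : nat -> 'rV[R]_d -> 'rV[R]_d.

(* The pair of the iterate of index k and the value prev_value at k. *)
Fixpoint dual_state V (k : nat) : 'rV[R]_d * 'rV[R]_d :=
  if k is k'.+1 then
    let s := dual_state V k' in
    (s.1 + step_weight R N k' *: (V k' s.1 - s.2), V k' s.1)
  else (x0, x0).

Definition dual_path V k := (dual_state V k).1.

Lemma dual_path_follows V : follows_dual_halpern N x0 (dual_path V)
  (fun k => V k (dual_path V k)).
Proof. by split=> // k _; rewrite {1}/dual_path/=; case: k. Qed.

Lemma generated_iteratesE V (x : nat -> 'rV[R]_d) :
  generated_iterates N x0 V x -> forall k, (k <= N.-1)%N -> x k = dual_path V k.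
Proof.
move=> [x00 recx].
have h k : (k <= N.-1)%N ->
    x k = dual_path V k /\ prev_value x0 V x k = (dual_state V k).2.
  elim: k => [|k IHk] kN; first by rewrite x00.
  have [xk pk] := IHk (ltnW kN).
  by rewrite recx// pk /dual_path /= -/(dual_path V k) -xk.
by move=> k /h[].
Qed.

Lemma eq_dual_path V V' k : (forall i, (i < k)%N -> V i =1 V' i) ->
  dual_path V k = dual_path V' k.
Proof.
rewrite /dual_path => VV'; congr fst; elim: k VV' => [|k IHk]//= VV'.
rewrite VV'// IHk// => i ik; apply: VV'; exact: ltnW.
Qed.

End dual_path.

(** * Mean-square bounds along the path and the expected residual *)

Section dual_halpern_moments.
Context (R : realType) (d : nat) (dX dO : measure_display).
Context (Xi : measurableType dX) (mu : probability Xi R).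
Context (Omega : measurableType dO) (P : probability Omega R).
Variables (T : 'rV[R]_d -> 'rV[R]_d) (xstar x0 : 'rV[R]_d).
Variables (To : 'rV[R]_d -> Xi -> 'rV[R]_d) (tau : R).
Variables (N : nat) (B : nat -> nat) (xi : nat -> nat -> {RV P >-> Xi}).
Hypothesis Tne : nonexpansive T.
Hypothesis Txs : T xstar = xstar.
Hypothesis mTo : jointly_measurable To.
Hypothesis To_mean :
  forall y i, ('E_mu[fun z => (To y z 0 i)%R] = ((T y 0 i)%R)%:E)%E.
Hypothesis To_var :
  forall y, ('E_mu[fun z => (enorm (To y z - T y) ^+ 2)%R]
     <= ((tau ^+ 2)%R)%:E)%E.
Hypothesis To_lip :
  forall y y', ('E_mu[fun z => (enorm (To y z - To y' z) ^+ 2)%R]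
     <= ((enorm (y - y') ^+ 2)%R)%:E)%E.
Hypothesis N_gt1 : (1 < N)%N.
Hypothesis B_gt0 : forall k, (k < N.-1)%N -> (0 < B k)%N.
Hypothesis xi_law : forall k j, (k < N.-1)%N -> (j < B k)%N ->
  forall A, measurable A -> distribution P (xi k j) A = mu A.
Hypothesis xi_indep : independent_minibatches N.-1 B xi.

(** One predicate covers the algorithm ([predT]) and the comparison path in which batch k alone is
    exact ([predC1 k]). *)
Definition partial_batch (K : pred nat) (z : nat -> nat -> Xi) (k : nat) :
    'rV[R]_d -> 'rV[R]_d :=
  if K k then minibatch To (B k) (z k) else T.

Definition partial_path (K : pred nat) (k : nat) (w : Omega) : 'rV[R]_d :=
  dual_path N x0 (partial_batch K (fun i j => xi i j w)) k.

(** The source is an arbitrary measurable space so that Omega can be taken with the sigma-algebra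
    that omits one sample; only samples the path really uses must be measurable. *)
Lemma measurable_partial_path (dS : measure_display) (S : measurableType dS)
    (K : pred nat) (z : nat -> nat -> S -> Xi) (k : nat) :
  (forall i j, (i < k)%N -> K i -> (j < B i)%N ->
     measurable_fun [set: S] (z i j)) ->
  measurable_fun [set: S] (fun s => dual_path N x0
    (partial_batch K (fun i j => z i j s)) k : borel_rV R d).
Proof.
move=> mz; pose st s := dual_state N x0 (partial_batch K (fun i j => z i j s)).
suff [] : measurable_fun [set: S] (fun s => (st s k).1 : borel_rV R d) /\
    measurable_fun [set: S] (fun s => (st s k).2 : borel_rV R d) by [].
elim: k mz => [|k IHk] mz; first by split; exact: measurable_cst.
have [i j ik|m1 m2] := IHk; first exact/mz/ltnW.
have mV : measurable_fun [set: S] (fun s =>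
    partial_batch K (fun i j => z i j s) k (st s k).1 : borel_rV R d).
  rewrite /partial_batch; case: (boolP (K k)) => Kk; last exact: measurable_exact.
  by apply: measurable_minibatch => // j jB; exact: mz.
split=> //=; apply: measurable_rVD => //; apply: measurable_rVZ.
exact: measurable_rVB.
Qed.

Let fresh_batch k : (k < N.-1)%N -> forall j, (j < B k)%N ->
  fresh_sample P mu
    (id : Omega -> g_sigma_algebraType (others_cylinders N.-1 B xi k j))
    (xi k j).
Proof. by move=> kN j jB; exact: fresh_sample_others. Qed.

Let other_in_batch k : (k < N.-1)%N -> forall j l, (j < B k)%N ->
  (l < B k)%N -> l != j ->
  measurable_fun [set: g_sigma_algebraType (others_cylinders N.-1 B xi k j)]
    (xi k l : g_sigma_algebraType (others_cylinders N.-1 B xi k j) -> Xi).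
Proof.
move=> kN j l jB lB lj; apply: measurable_other_sample => //.
by rewrite xpair_eqE eqxx.
Qed.

(** A path avoids batch k for one of two reasons: it has not reached it yet (i <= k), or it uses the
    exact map there. *)
Lemma batch_measurable_partial_path K i k : (k < N.-1)%N -> (i <= N.-1)%N ->
  (i <= k)%N || ~~ K k ->
  batch_measurable (B k) (others_cylinders N.-1 B xi k) (partial_path K i).
Proof.
move=> kN iN ik j jB.
apply: (@measurable_partial_path _
  (g_sigma_algebraType (others_cylinders N.-1 B xi k j)) K
  (fun i' j' => xi i' j')) => i' j' i'i Ki' j'B.
apply: measurable_other_sample => //; last exact: leq_trans iN.
rewrite xpair_eqE; case: eqVneq => //= i'k.
by move: ik; rewrite -i'k Ki' orbF leqNgt i'i.
Qed.

(** A random batch value is T plus noise: T preserves square integrability, and the noise has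
    bounded variance because the current iterate precedes the batch. *)
Lemma square_integrable_partial_path K k : (k <= N.-1)%N ->
  square_integrable P (partial_path K k : Omega -> borel_rV R d).
Proof.
move=> kN; pose st w := dual_state N x0 (partial_batch K (fun i j => xi i j w)).
suff [] : square_integrable P (fun w => (st w k).1 : borel_rV R d) /\
    square_integrable P (fun w => (st w k).2 : borel_rV R d) by [].
elim: k kN => [|k IHk] kN; first by split; exact: square_integrable_cst.
have [s1 s2] := IHk (ltnW kN).
have sT := square_integrable_nonexpansive Tne Txs s1.
have sV : square_integrable P (fun w =>
    partial_batch K (fun i j => xi i j w) k (st w k).1 : borel_rV R d).
  rewrite /partial_batch; case: (boolP (K k)) => Kk //.
  have mX := batch_measurable_partial_path (K := K) (i := k) kN (ltnW kN).
  rewrite leqnn in mX; have {}mX := mX isT.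
  have mXO := batch_measurable_ambient (B_gt0 kN) (fresh_batch kN) mX.
  have var := minibatch_var Tne mTo To_mean To_var (B_gt0 kN)
    (fresh_batch kN) (other_in_batch kN) mX.
  have sE : square_integrable P (fun w => minibatch To (B k)
      (fun j => xi k j w) (st w k).1 - T (st w k).1 : borel_rV R d).
    split; last by exists (tau ^+ 2 / (B k)%:R).
    apply: measurable_rVB; last exact: measurable_exact.
    by apply: measurable_minibatch => // j jB; have [] := fresh_batch kN jB.
  have := square_integrableD sE sT.
  by under eq_fun => w do rewrite subrK.
split=> //=; apply: square_integrableD => //; apply: square_integrableZ.
exact: square_integrableB.
Qed.

Let full := partial_path predT.
Let without k := partial_path (predC1 k).

(** Strong induction, as an iterate mixes all earlier batch values. At j = k the paths still
    coincide, so the values differ by the noise of batch k alone; at j <> k both use the same map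
    and the mean-square distance does not grow. *)
Lemma mean_le_without k i : (k < N.-1)%N -> (i <= N.-1)%N ->
  mean_le P (fun w => enorm (full i w - without k i w) ^+ 2)
    (tau ^+ 2 / (B k)%:R).
Proof.
move=> kN; have v0 : 0 <= tau ^+ 2 / (B k)%:R by rewrite divr_ge0// sqr_ge0.
elim/ltn_ind: i => -[|i] IHi iN.
  apply: (mean_leW v0); have := mean_le_cst P (0 : R); congr mean_le.
  by apply/funext => w; rewrite subrr sqr_enorm big1// => l _; rewrite mxE expr0n.
apply: (@mean_leW _ _ _ _ _
  (\sum_(j < i.+1) mix_weight R N i j * (tau ^+ 2 / (B k)%:R))).
  by rewrite -mulr_suml ler_piMl// sum_mix_weight_le1.
pose Y K j w := partial_batch K (fun i j => xi i j w) j (partial_path K j w).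
apply: (@mean_le_dominated _ _ _ _ (fun w => \sum_(j < i.+1)
  mix_weight R N i j * enorm (Y predT j w - Y (predC1 k) j w) ^+ 2)).
- have [m1 _] := square_integrable_partial_path predT iN.
  have [m2 _] := square_integrable_partial_path (predC1 k) iN.
  by apply/measurable_sqr_enorm/measurable_rVB.
- move=> w; rewrite sqr_ge0/=.
  exact: (dual_halpern_stability (dual_path_follows N x0 _)
    (dual_path_follows N x0 _)).
- apply: mean_le_sum => j; apply: mean_leZ; first exact: mix_weight_ge0.
  have jN : (j < N.-1)%N by apply: leq_trans iN; exact: ltn_ord.
  have mX := batch_measurable_partial_path (K := predT) jN (ltnW jN).
  rewrite leqnn in mX; have {}mX := mX isT.
  have mX' := batch_measurable_partial_path (K := predC1 k) jN (ltnW jN).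
  rewrite leqnn in mX'; have {}mX' := mX' isT.
  rewrite /Y /partial_batch/=; case: eqVneq => [jk|jk].
    have -> : partial_path (predC1 k) j = full j.
      apply/funext => w; apply: eq_dual_path => l lj x.
      by rewrite /partial_batch/= ifT// neq_ltn -jk lj.
    rewrite /= -jk.
    exact: (minibatch_var Tne mTo To_mean To_var (B_gt0 jN)
      (fresh_batch jN) (other_in_batch jN) mX).
  exact: (minibatch_lip mTo To_lip (B_gt0 jN) (fresh_batch jN) mX mX'
    (IHi _ (ltn_ord j) (ltnW jN))).
Qed.

Lemma dual_halpern_mean_residual :
  mean_le P (fun w => enorm (full N.-1 w - T (full N.-1 w)) ^+ 2)
    (4 / N%:R ^+ 2 * enorm (x0 - xstar) ^+ 2 +
     \sum_(k < N.-1) 6 * (acoef R N k * (tau ^+ 2 / (B k)%:R))).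
Proof.
pose Y k w := minibatch To (B k) (fun j => xi k j w) (full k w).
apply: (@mean_le_dominated _ _ _ _ (fun w =>
    4 / N%:R ^+ 2 * enorm (x0 - xstar) ^+ 2 +
    \sum_(k < N.-1) 2 * acoef R N k *
      (2 * dot (Y k w - T (full k w)) (T (full k w) - T (without k N.-1 w)) +
       2 * enorm (Y k w - T (full k w)) ^+ 2 +
       enorm (without k N.-1 w - full N.-1 w) ^+ 2))).
- have s := square_integrable_partial_path predT (leqnn N.-1).
  have [m1 _] := square_integrable_nonexpansive Tne Txs s.
  have [m2 _] := s.
  by apply/measurable_sqr_enorm/measurable_rVB.
- move=> w; rewrite sqr_ge0/=.
  exact: (dual_halpern_residual (X := full^~ w) (fun k => without k N.-1 w)
    Tne Txs N_gt1 (dual_path_follows N x0 _)).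
apply: mean_leD; first exact: mean_le_cst.
apply: mean_le_sum => k; have kN := ltn_ord k.
(* 6 = 2 (2 + 1): twice the noise variance plus once the distance to the comparison path, with mean
   zero for the cross term. *)
have -> : 6 * (acoef R N k * (tau ^+ 2 / (B k)%:R)) = 2 * acoef R N k *
   (2 * 0 + 2 * (tau ^+ 2 / (B k)%:R) + tau ^+ 2 / (B k)%:R) by ring.
apply: mean_leZ; first by rewrite mulr_ge0// acoef_ge0.
have mX := batch_measurable_partial_path (K := predT) kN (ltnW kN).
rewrite leqnn in mX; have {}mX := mX isT.
have mX' : batch_measurable (B k) (others_cylinders N.-1 B xi k)
    (without k N.-1).
  by apply: batch_measurable_partial_path => //=; rewrite eqxx orbT.
have sT := square_integrable_nonexpansive Tne Txs
  (square_integrable_partial_path predT (ltnW kN)).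
have sT' := square_integrable_nonexpansive Tne Txs
  (square_integrable_partial_path (predC1 (k : nat)) (leqnn N.-1)).
apply: mean_leD; first apply: mean_leD; first apply: mean_leZ => //.
(* Both vectors in the difference are independent of batch k: [full k] stops before it and
   [without k] skips it. *)
- apply: (minibatch_cross Tne mTo To_mean To_var (B_gt0 kN) (fresh_batch kN) mX
    (Z := fun w => T (full k w) - T (without k N.-1 w))).
  + move=> j jB; apply: measurable_rVB; apply: measurable_exact => //.
      exact: mX.
    exact: mX'.
  + exact: square_integrableB.
- apply: mean_leZ => //.
  exact: (minibatch_var Tne mTo To_mean To_var (B_gt0 kN)
      (fresh_batch kN) (other_in_batch kN) mX).
- have := mean_le_without kN (leqnn N.-1); congr mean_le.
  by apply/funext => w; rewrite -dotxx -opprB -scaleN1r dotZr dotC dotZr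
    mulN1r mulN1r opprK dotxx.
Qed.

End dual_halpern_moments.

(* The constant C of the O(.) is absolute.  The bound is by max(1, complexity)
   since at least one oracle evaluation is always made, while the complexity
   expression can be arbitrarily small (it is 0 when D = tau = 0). *)
Theorem corollary2p3 (R : realType) :
  exists2 C : R, 0 < C &
  forall (d : nat) (T : 'rV[R]_d -> 'rV[R]_d) (xstar : 'rV[R]_d)
    (dX : measure_display) (Xi : measurableType dX) (mu : probability Xi R)
    (To : 'rV[R]_d -> Xi -> 'rV[R]_d) (tau eps D : R) (x0 : 'rV[R]_d)
    (dO : measure_display) (Omega : measurableType dO)
    (P : probability Omega R) (xi : nat -> nat -> {RV P >-> Xi})
    (x : nat -> Omega -> 'rV[R]_d),
  nonexpansive T ->
  T xstar = xstar ->
  jointly_measurable To ->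
  (forall y i, 'E_mu[fun z => (To y z 0 i)%R] = ((T y 0 i)%R)%:E)%E ->
  (forall y, 'E_mu[fun z => (enorm (To y z - T y) ^+ 2)%R]
     <= ((tau ^+ 2)%R)%:E)%E ->
  (forall y y', 'E_mu[fun z => (enorm (To y z - To y' z) ^+ 2)%R]
     <= ((enorm (y - y') ^+ 2)%R)%:E)%E ->
  0 < eps ->
  enorm (x0 - xstar) <= D ->
  let N := horizon D eps in
  let B := batch_size tau eps N in
  (forall k j, (k < N.-1)%N -> (j < B k)%N ->
     forall A, measurable A -> distribution P (xi k j) A = mu A) ->
  independent_minibatches N.-1 B xi ->
  (forall w, generated_iterates N x0
     (fun k => minibatch To (B k) (fun j => xi k j w)) (fun k => x k w)) ->
  ('E_P[fun w => (enorm (x N.-1 w - T (x N.-1 w)) ^+ 2)%R]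
     <= ((eps ^+ 2)%R)%:E)%E /\
  (oracle_evaluations N B)%:R <= C * Num.max 1 (complexity D tau eps).
Proof.
exists 130 => // d T xstar dX Xi mu To tau eps D x0 dO Omega P xi x.
move=> Tne Txs mTo To_mean To_var To_lip e0 x0D N B xi_law xi_indep gen.
have D0 : 0 <= D by apply: le_trans x0D; exact: enorm_ge0.
split; last exact: oracle_evaluations_complexity.
have N1 : (1 < N)%N := horizon_gt1 D eps.
have [_] := dual_halpern_mean_residual x0 Tne Txs mTo To_mean To_var To_lip N1
  (fun k kN => batch_size_gt0 tau eps N1 kN) xi_law xi_indep.
rewrite expectation.unlock.
under eq_integral => w _.
  rewrite [partial_path _ _ _ _ _ _ _ _ _](_ : _ = x N.-1 w); last first.
    by rewrite (generated_iteratesE (gen w)).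
  over.
move=> /le_trans; apply; rewrite lee_fin -mulr_sumr.
(* The noise contributes at most 6 eps^2 / 8, which leaves eps^2 / 4 for the initial distance. *)
have := batch_noise_le tau N1 e0; rewrite -/B.
(* N >= 4 D / eps gives |x0 - xstar| <= eps N / 4. *)
have : 4 / N%:R ^+ 2 * enorm (x0 - xstar) ^+ 2 <= eps ^+ 2 / 4.
  have N0 : 0 < N%:R :> R by rewrite ltr0n; lia.
  have bnd : enorm (x0 - xstar) <= eps * N%:R / 4.
    have := horizon_ge D0 e0; rewrite ler_pdivrMr// -/N mulrC; lra.
  rewrite (_ : eps ^+ 2 / 4 = 4 / N%:R ^+ 2 * (eps * N%:R / 4) ^+ 2).
    rewrite ler_wpM2l ?divr_ge0 ?sqr_ge0// lerXn2r// nnegrE ?enorm_ge0//.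
    exact: le_trans (enorm_ge0 _) bnd.
  by field; rewrite gt_eqF.
lra.
Qed.
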